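(* Let $(R,\mathfrak{m})$ be a Cohen–Macaulay local ring of dimension $3$ with infinite residue field, and let $I$ be an $\mathfrak{m}$-primary integrally closed ideal. If $e_1(I)-e_0(I)+\lambda(R/I)=e_2(I)$, then $e_3(I)\le 0$.
   Context: $\lambda(\cdot)$ denotes length. For an $\mathfrak{m}$-primary ideal $I$, $\lambda(R/I^n)$ agrees for all large $n$ with $P_I(n)=e_0\binom{n+2}{3}-e_1\binom{n+1}{2}+e_2\binom{n}{1}-e_3$; the $e_i(I)$ are the Hilbert coefficients. $I$ is integrally closed if $\overline{I}=I$. *)

(* Defs.v *)
From HB Require Import structures.
From mathcomp Require Import all_boot all_order all_algebra.
Set Implicit Arguments. Unset Strict Implicit. Unset Printing Implicit Defensive.
Import Order.TTheory GRing.Theory Num.Theory.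
Local Open Scope ring_scope.

Section CommAlg.
Variable R : comNzRingType.

Definition subset (A B : R -> Prop) := forall x, A x -> B x.
Definition sameset (A B : R -> Prop) := forall x, A x <-> B x.
Definition strict_subset (A B : R -> Prop) := subset A B /\ exists x, B x /\ ~ A x.

Definition is_ideal (I : R -> Prop) : Prop :=
  I 0 /\ (forall x y, I x -> I y -> I (x + y)) /\ (forall a x, I x -> I (a * x)).

Definition proper_ideal (I : R -> Prop) := is_ideal I /\ ~ I 1.

Definition prime_ideal (P : R -> Prop) :=
  proper_ideal P /\ forall x y, P (x * y) -> P x \/ P y.

Definition maximal_ideal (M : R -> Prop) :=
  proper_ideal M /\
  forall J, is_ideal J -> subset M J -> sameset J M \/ J 1.

Definition local_ring (m : R -> Prop) :=
  maximal_ideal m /\ forall J, proper_ideal J -> subset J m.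

Definition noetherian : Prop :=
  forall C : nat -> R -> Prop,
    (forall n, is_ideal (C n)) -> (forall n, subset (C n) (C n.+1)) ->
    exists N, forall n, (N <= n)%N -> sameset (C n) (C N).

Definition prime_chain (P : nat -> R -> Prop) (k : nat) :=
  (forall i, (i <= k)%N -> prime_ideal (P i)) /\
  (forall i, (i < k)%N -> strict_subset (P i) (P i.+1)).

Definition krull_dim (d : nat) :=
  (exists P, prime_chain P d) /\ ~ (exists P, prime_chain P d.+1).

Definition gen_ideal (s : seq R) (x : R) :=
  exists c : seq R, size c = size s /\ x = \sum_(i < size s) c`_i * s`_i.

Definition regular_seq (m : R -> Prop) (s : seq R) :=
  (forall i, (i < size s)%N -> m s`_i) /\
  (forall i, (i < size s)%N -> forall y,
      gen_ideal (take i s) (s`_i * y) -> gen_ideal (take i s) y).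

Definition depth (m : R -> Prop) (d : nat) :=
  (exists s, size s = d /\ regular_seq m s) /\
  (forall s, regular_seq m s -> (size s <= d)%N).

Definition cohen_macaulay (m : R -> Prop) :=
  exists d, krull_dim d /\ depth m d.

Definition infinite_residue (m : R -> Prop) :=
  exists f : nat -> R, forall i j, m (f i - f j) -> i = j.

Definition prod_ideal (I J : R -> Prop) (x : R) :=
  exists s : seq (R * R), (forall p, p \in s -> I p.1 /\ J p.2) /\
                          x = \sum_(p <- s) p.1 * p.2.

Fixpoint ideal_pow (I : R -> Prop) (n : nat) : R -> Prop :=
  match n with
  | 0 => fun _ => True
  | n'.+1 => prod_ideal I (ideal_pow I n')
  end.

Definition m_primary (m I : R -> Prop) :=
  proper_ideal I /\
  (forall a b, I (a * b) -> ~ I a -> exists k, I (b ^+ k)) /\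
  (forall x, m x <-> exists k, I (x ^+ k)).

Definition integral_over_ideal (I : R -> Prop) (x : R) :=
  exists (n : nat) (a : nat -> R), (0 < n)%N /\
    (forall i, (1 <= i <= n)%N -> ideal_pow I i (a i)) /\
    x ^+ n + \sum_(1 <= i < n.+1) a i * x ^+ (n - i) = 0.

Definition integrally_closed (I : R -> Prop) :=
  subset (integral_over_ideal I) I.

(* length of R/J: maximal length of a strict chain of ideals J = C0 < ... < Ck = R
   (ideals containing J correspond to submodules of R/J). *)
Definition ideal_chain (J : R -> Prop) (C : nat -> R -> Prop) (k : nat) :=
  sameset (C 0%N) J /\ sameset (C k) (fun _ => True) /\
  (forall i, (i <= k)%N -> is_ideal (C i)) /\
  (forall i, (i < k)%N -> strict_subset (C i) (C i.+1)).

Definition quot_length (J : R -> Prop) (l : nat) :=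
  (exists C, ideal_chain J C l) /\
  (forall C k, ideal_chain J C k -> (k <= l)%N).

End CommAlg.

Definition hilbP (e0 e1 e2 e3 : int) (n : nat) : int :=
  e0 * ('C(n + 2, 3))%:Z - e1 * ('C(n + 1, 2))%:Z + e2 * n%:Z - e3.

(* Main.v *)
(* Let [x], [y], [z] be a superficial sequence in [I]; as [R] is Cohen-Macaulay and the residue
   field is infinite, one exists and it is regular. Let F be the Ratliff-Rush filtration of [I]
   with respect to [x], and G that of [I R/(x)] with respect to [y]. Superficiality makes the
   colengths of F and G sums of colengths modulo [x] and [y], and bounds the first difference of
   h(n) = length(R/(G_n + (y))) by [e0]. Hence length(R/G_n) minus its Hilbert polynomial P' is
   nondecreasing for n >= 1, and it vanishes at n = 1 exactly by the hypothesis on the [e_i], as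
   soon as G_1 = I. Since F_n + (x) lies in G_n, summing length(R/(F_n + (x))) >= P'(n) gives
   P(n) >= P(n) + e3 for large n.

   The equality G_1 = I is where integral closedness enters: if [a y^k] is in [I^(k+1) + (x)],
   then [a] is integral over [I]. Expanding powers of [a y^k = b + x c] shows that [a^l] lies in
   [I^(l - O(sqrt l))]. Comparing the lengths of the Rees pieces generated by 1, a, ..., a^j with
   the cubic Hilbert polynomial then yields a relation [f a^i = sum_(l < i) a^l v_l] in which [f]
   is a form in [x], [y], [z] with a leading coefficient 1; such an [f] is a nonzerodivisor on the
   associated graded ring of [(x, y, z)], so [a^l] is in [I^(l - C)] for a constant [C], and
   noetherianity of the Rees algebra finishes the proof. *)
From Stdlib Require Import Classical ClassicalEpsilon FunctionalExtensionality PropExtensionality.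
Require Import Defs.
From HB Require Import structures.
From mathcomp Require Import all_boot all_order all_algebra.
From mathcomp Require Import ring zify.
Import Order.TTheory GRing.Theory Num.Theory.
Import Defs.
Set Implicit Arguments. Unset Strict Implicit. Unset Printing Implicit Defensive.
Local Open Scope ring_scope.

(** * Ideal arithmetic: sums, principal ideals, colons and powers *)

Section Ideals.
Variable R : comNzRingType.
Implicit Types (I J K L Q : R -> Prop) (a b u v w x y z : R).

Definition addI K L : R -> Prop := fun w => exists u v, K u /\ L v /\ w = u + v.
Definition prI x : R -> Prop := fun w => exists r, w = r * x.
Definition zeroI : R -> Prop := fun w => w = 0.
Definition quotI K x : R -> Prop := fun w => K (x * w).

Lemma idl0 K : is_ideal K -> K 0. Proof. by case. Qed.
Lemma idlD K u v : is_ideal K -> K u -> K v -> K (u + v).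
Proof. by move=> [_ [h _]]; apply: h. Qed.
Lemma idlM K a u : is_ideal K -> K u -> K (a * u).
Proof. by move=> [_ [_ h]]; apply: h. Qed.
Lemma idlMr K a u : is_ideal K -> K u -> K (u * a).
Proof. by move=> hK hu; rewrite mulrC; apply: idlM. Qed.
Lemma idlN K u : is_ideal K -> K u -> K (- u).
Proof. by move=> hK hu; rewrite -mulN1r; apply: idlM. Qed.
Lemma idlB K u v : is_ideal K -> K u -> K v -> K (u - v).
Proof. by move=> hK hu hv; apply: idlD => //; apply: idlN. Qed.
Lemma idlMn K u n : is_ideal K -> K u -> K (u *+ n).
Proof. by move=> hK hu; rewrite -mulr_natl; apply: idlM. Qed.
Lemma idl_sum K (T : Type) (s : seq T) (P : pred T) (F : T -> R) :
  is_ideal K -> (forall i, P i -> K (F i)) -> K (\sum_(i <- s | P i) F i).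
Proof.
by move=> hK hF; apply: big_ind => //; [apply: idl0 | move=> *; apply: idlD].
Qed.

Lemma zero_ideal : is_ideal zeroI.
Proof. by split=> //; split=> [u v -> ->|a u ->]; rewrite /zeroI ?addr0 ?mulr0. Qed.

Lemma full_ideal : is_ideal (fun _ : R => True). Proof. by []. Qed.

Lemma pr_ideal x : is_ideal (prI x).
Proof.
split; first by exists 0; rewrite mul0r.
split=> [u v [r ->] [s ->]|a u [r ->]]; first by exists (r + s); rewrite mulrDl.
by exists (a * r); rewrite mulrA.
Qed.

Lemma prI_self x : prI x x. Proof. by exists 1; rewrite mul1r. Qed.
Lemma prI_mul x r : prI x (x * r). Proof. by exists r; rewrite mulrC. Qed.

Lemma add_ideal K L : is_ideal K -> is_ideal L -> is_ideal (addI K L).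
Proof.
move=> hK hL; split; first by exists 0, 0; rewrite addr0; do ![split; first exact: idl0].
split=> [_ _ [u [v [hu [hv ->]]]] [u' [v' [hu' [hv' ->]]]]|a _ [u [v [hu [hv ->]]]]].
  exists (u + u'), (v + v'); split; first exact: idlD.
  by split; [exact: idlD | ring].
by exists (a * u), (a * v); split; [exact: idlM|split; [exact: idlM|ring]].
Qed.

Lemma sub_addl K L : is_ideal L -> subset K (addI K L).
Proof. by move=> hL u hu; exists u, 0; rewrite addr0; split=> //; split=> //; apply: idl0. Qed.
Lemma sub_addr K L : is_ideal K -> subset L (addI K L).
Proof. by move=> hK u hu; exists 0, u; rewrite add0r; split=> //; apply: idl0. Qed.
Lemma addIS K K' L L' : subset K K' -> subset L L' -> subset (addI K L) (addI K' L').
Proof. by move=> h h' _ [u [v [hu [hv ->]]]]; exists u, v; split; [apply: h|split; [apply: h'|]]. Qed.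
Lemma addI_sub K L M : is_ideal M -> subset K M -> subset L M -> subset (addI K L) M.
Proof. by move=> hM h h' _ [u [v [hu [hv ->]]]]; apply: idlD => //; [apply: h|apply: h']. Qed.

Lemma addIA K L M : subset (addI (addI K L) M) (addI K (addI L M)).
Proof.
move=> _ [_ [w [[u [v [hu [hv ->]]]] [hw ->]]]].
by exists u, (v + w); split=> //; split; [exists v, w|rewrite addrA].
Qed.
Lemma addIAr K L M : subset (addI K (addI L M)) (addI (addI K L) M).
Proof.
move=> _ [u [_ [hu [[v [w [hv [hw ->]]]] ->]]]].
by exists (u + v), w; split; [exists u, v|split=> //; rewrite addrA].
Qed.

Lemma pr_sub K x : is_ideal K -> K x -> subset (prI x) K.
Proof. by move=> hK hx _ [r ->]; apply: idlM. Qed.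

Lemma quot_ideal K x : is_ideal K -> is_ideal (quotI K x).
Proof.
move=> hK; split; first by rewrite /quotI mulr0; apply: idl0.
split=> [u v hu hv|a u hu]; rewrite /quotI.
  by rewrite mulrDr; apply: idlD.
by rewrite mulrCA; apply: idlM.
Qed.

Lemma prod_ind I J (P : R -> Prop) : P 0 -> (forall u v, P u -> P v -> P (u + v)) ->
  (forall u v, I u -> J v -> P (u * v)) -> forall w, prod_ideal I J w -> P w.
Proof.
move=> P0 PD Pm _ [s [hs ->]]; elim: s hs => [|p s IH] hs; first by rewrite big_nil.
rewrite big_cons; apply: PD; last by apply: IH => q hq; apply: hs; rewrite inE hq orbT.
by have [h1 h2] := hs p (mem_head _ _); apply: Pm.
Qed.

Lemma prod_sub I J K : is_ideal K -> (forall u v, I u -> J v -> K (u * v)) ->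
  subset (prod_ideal I J) K.
Proof.
move=> hK h w; apply: prod_ind => //; first exact: idl0.
by move=> *; apply: idlD.
Qed.

Lemma prod_mul I J u v : I u -> J v -> prod_ideal I J (u * v).
Proof.
by move=> hu hv; exists [:: (u, v)]; rewrite big_seq1; split=> // p; rewrite inE => /eqP ->.
Qed.

Lemma prod_is_ideal I J : is_ideal J -> is_ideal (prod_ideal I J).
Proof.
move=> hJ; split; first by exists [::]; rewrite big_nil.
have hD : forall u v, prod_ideal I J u -> prod_ideal I J v -> prod_ideal I J (u + v).
  move=> _ _ [s [hs ->]] [t [ht ->]]; exists (s ++ t); rewrite big_cat; split=> // p.
  by rewrite mem_cat => /orP[]; [apply: hs|apply: ht].
split=> // a; apply: (@prod_ind _ _ (fun u => prod_ideal I J (a * u))).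
- by rewrite mulr0; exists [::]; rewrite big_nil.
- by move=> v w hv hw; rewrite mulrDr; apply: hD.
by move=> v w hv hw; rewrite mulrCA; apply: prod_mul => //; apply: idlM.
Qed.

Lemma pow_ideal I n : is_ideal (ideal_pow I n).
Proof. by elim: n => [|n IH] //=; apply: prod_is_ideal. Qed.

Lemma powS I n u v : I u -> ideal_pow I n v -> ideal_pow I n.+1 (u * v).
Proof. exact: prod_mul. Qed.

Lemma powM I m n u v : ideal_pow I m u -> ideal_pow I n v -> ideal_pow I (m + n) (u * v).
Proof.
move=> + hv; elim: m u => [|m IH] u hu.
  by rewrite add0n; apply: idlM => //; apply: pow_ideal.
have hP := pow_ideal I (m.+1 + n); move: u hu; apply: prod_ind.
- by rewrite mul0r; apply: idl0.
- by move=> a b ha hb; rewrite mulrDl; apply: idlD.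
by move=> a b ha hb; rewrite -mulrA; apply: powS => //; apply: IH.
Qed.

Lemma pow_leS I n : subset (ideal_pow I n.+1) (ideal_pow I n).
Proof. by apply: prod_sub => [|u v _ hv]; [apply: pow_ideal|apply: idlM; first exact: pow_ideal]. Qed.

Lemma pow_le I m n : (m <= n)%N -> subset (ideal_pow I n) (ideal_pow I m).
Proof.
move=> /subnKC <-; elim: (n - m)%N => [|k IH] u; rewrite ?addn0 // addnS.
by move=> /pow_leS; apply: IH.
Qed.

Lemma pow1 I u : I u -> ideal_pow I 1 u.
Proof. by move=> hu; rewrite -[u]mulr1; apply: powS. Qed.

Lemma powX I m u k : ideal_pow I m u -> ideal_pow I (m * k) (u ^+ k).
Proof.
move=> hu; elim: k => [|k IH]; first by rewrite muln0.
by rewrite exprS mulnS; apply: powM.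
Qed.

Lemma pow1X I u k : I u -> ideal_pow I k (u ^+ k).
Proof. by move=> hu; rewrite -[k in ideal_pow I k]mul1n; apply: powX; apply: pow1. Qed.

Lemma pow_add I m n : subset (ideal_pow I (m + n)) (prod_ideal (ideal_pow I m) (ideal_pow I n)).
Proof.
elim: m => [|m IH] w.
  by rewrite add0n => hw; rewrite -[w]mul1r; apply: prod_mul.
have hP := prod_is_ideal (ideal_pow I m.+1) (pow_ideal I n).
move=> hw; move: w hw; rewrite addSn; apply: prod_sub => // u v hu /IH.
move: v; apply: prod_ind; first by rewrite mulr0; apply: idl0.
  by move=> a b ha hb; rewrite mulrDr; apply: idlD.
by move=> a b ha hb; rewrite mulrA; apply: prod_mul => //; apply: powS.
Qed.

Definition nzd Q x := forall w, Q (x * w) -> Q w.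

Lemma nzdX Q x k : nzd Q x -> nzd Q (x ^+ k).
Proof.
move=> h; elim: k => [|k IH] w; first by rewrite expr0 mul1r.
by rewrite exprS -mulrA => /h /IH.
Qed.

Lemma not_subset_ex K L : ~ subset K L -> exists x, K x /\ ~ L x.
Proof.
move=> h; apply: NNPP => hn; apply: h => x hx; apply: NNPP => hnx; apply: hn; by exists x.
Qed.
End Ideals.

Ltac ideal := repeat first
  [ assumption | apply: add_ideal | apply: pr_ideal | apply: pow_ideal
  | apply: zero_ideal | apply: quot_ideal | apply: full_ideal ].

(** * Colength of ideals through strict chains *)

Section Length.
Variable R : comNzRingType.
Implicit Types (I J K L Q : R -> Prop) (a b u v w x y z : R).

(** The top of the chain is left free, unlike in [ideal_chain], so that chains concatenate and the
    bottom can be shrunk. The maximal length is the same, since a chain can be completed by the unit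
    ideal. *)
Fixpoint chain_above (n : nat) K : Prop :=
  is_ideal K /\
  if n is n'.+1 then exists L, strict_subset K L /\ chain_above n' L else True.

Definition has_length K l := chain_above l K /\ forall k, chain_above k K -> (k <= l)%N.
Definition fin_length K := exists l, has_length K l.
Definition len K : nat := epsilon (inhabits 0%N) (has_length K).

Lemma chain_above_ideal n K : chain_above n K -> is_ideal K.
Proof. by case: n => [|n] []. Qed.

Lemma lenP K : fin_length K -> has_length K (len K).
Proof. by move=> h; apply: epsilon_spec. Qed.

Lemma len_eq K l : has_length K l -> len K = l.
Proof.
move=> h; have [c m] := lenP (ex_intro _ l h); case: h => c' m'.
by apply/eqP; rewrite eqn_leq m' // m.
Qed.

Lemma ideal_chain_above k C K : ideal_chain K C k -> chain_above k K.
Proof.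
move=> [h0 [_ []]]; elim: k C K h0 => [|k IH] C K h0 hi hs.
  split=> //; have := hi 0%N isT; case=> a [b c]; split; first by apply/h0.
  by split=> [u v /h0 hu /h0 hv|u v /h0 hu]; apply/h0; [apply: b|apply: c].
split.
  have := hi 0%N isT; case=> a [b c]; split; first by apply/h0.
  by split=> [u v /h0 hu /h0 hv|u v /h0 hu]; apply/h0; [apply: b|apply: c].
exists (C 1%N); split.
  have [hsub [u [h1 h2]]] := hs 0%N isT; split; first by move=> v /h0; apply: hsub.
  by exists u; split=> // /h0.
by apply: (IH (fun i => C i.+1)) => // i hi'; [apply: hi|apply: hs].
Qed.

Lemma chain_above_ideal_chain k K :
  chain_above k K -> exists k' C, (k <= k')%N /\ ideal_chain K C k'.
Proof.
elim: k K => [|k IH] K [hK].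
  move=> _; have [h1|h1] := classic (K 1).
    exists 0%N, (fun _ => K); split=> //; split=> //; split=> // u; split=> // _.
    by rewrite -[u]mulr1; apply: idlM.
  exists 1%N, (fun i => if i is 0 then K else fun _ => True); split=> //.
  split=> //; split=> //; split; first by case.
  by case=> // _; split=> //; exists 1.
move=> [L [hKL /IH [k' [C [hk [h0 [h1 [hi hs]]]]]]]].
exists k'.+1, (fun i => if i is i'.+1 then C i' else K); split=> //.
split=> //; split=> //; split; first by case=> // i; apply: hi.
case=> [_|i]; last exact: hs.
have [hsub [u [hu1 hu2]]] := hKL.
by split=> [v /hsub /h0|] //; exists u; split=> //; apply/h0.
Qed.

Lemma quot_length_has_length K l : quot_length K l -> has_length K l.
Proof.
move=> [[C hC] hm]; split; first exact: ideal_chain_above hC.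
by move=> k /chain_above_ideal_chain [k' [C' [hk /hm]]]; apply: leq_trans.
Qed.

Lemma chain_above_le n K L : is_ideal K -> subset K L -> chain_above n L -> chain_above n K.
Proof.
case: n => [|n] hK hKL [hL] //= [M [[hs [u [h1 h2]]] hM]]; split=> //.
exists M; split=> //; split; first by move=> v /hKL /hs.
by exists u; split=> // /hKL.
Qed.

Lemma fin_length_le K L : is_ideal L -> subset K L -> fin_length K -> is_ideal K -> fin_length L.
Proof.
move=> hL hKL [l [_ hm]] hK.
have hb k : chain_above k L -> (k <= l)%N by move/(chain_above_le hK hKL); apply: hm.
have : exists n, chain_above n L /\ (n <= l)%N by exists 0%N.
elim: l hb {hm} => [|l IH] hb [n [hn hnl]].
  by exists 0%N; split=> //; move: hnl hn; rewrite leqn0 => /eqP ->.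
have [h|h] := classic (chain_above l.+1 L); first by exists l.+1; split.
apply: IH => [k hk|]; last by exists 0%N.
by have := hb k hk; rewrite leq_eqVlt => /orP[/eqP e|//]; move: hk; rewrite e.
Qed.

Lemma len_le K L : is_ideal K -> is_ideal L -> subset K L -> fin_length K -> (len L <= len K)%N.
Proof.
move=> hK hL hKL hf; have [cK mK] := lenP hf.
have [cL _] := lenP (fin_length_le hL hKL hf hK).
by apply: mK; apply: chain_above_le cL.
Qed.

Lemma len_full : len (fun _ : R => True) = 0%N.
Proof. by apply: len_eq; split=> // -[|k] //= [_ [L [[_ [u []]]]]]. Qed.

Lemma len_eq_sub K L : is_ideal K -> is_ideal L -> subset K L -> fin_length K ->
  len L = len K -> subset L K.
Proof.
move=> hK hL hKL hf e u hu; apply: NNPP => hn.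
have [_ mK] := lenP hf; have [cL _] := lenP (fin_length_le hL hKL hf hK).
have /mK : chain_above (len L).+1 K.
  by split=> //; exists L; split=> //; split=> //; exists u.
by rewrite e ltnn.
Qed.

Definition scaleI x L : R -> Prop := fun w => exists2 r, L r & w = x * r.

Lemma scale_ideal x L : is_ideal L -> is_ideal (scaleI x L).
Proof.
move=> hL; split; first by exists 0; rewrite ?mulr0 //; apply: idl0.
split=> [_ _ [r hr ->] [s hs ->]|a _ [r hr ->]].
  by exists (r + s); [apply: idlD|rewrite mulrDr].
by exists (a * r); [apply: idlM|rewrite mulrCA].
Qed.

(** Let [L] run through the chain above [K : x]: the ideals [K + x L] climb strictly from [K] up to
    [K + (x)], where the other chain takes over. *)
Lemma chain_above_quot_add K x m n : is_ideal K ->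
  chain_above m (addI K (prI x)) -> chain_above n (quotI K x) -> chain_above (m + n) K.
Proof.
move=> hK hm hn.
suff key L : subset (quotI K x) L -> chain_above n L ->
    chain_above (m + n) (addI K (scaleI x L)).
  apply: chain_above_le (key _ _ hn) => //; apply: sub_addl; apply: scale_ideal.
  exact: quot_ideal.
elim: {hn} n L => [|n IH] L hq hL; have iL := chain_above_ideal hL.
  rewrite addn0; apply: chain_above_le hm; first exact: add_ideal hK (scale_ideal x iL).
  by apply: addIS => // _ [r _ ->]; exact: prI_mul.
have [_ [L1 [[hs [u [h1 h2]]] hL1]]] := hL.
rewrite addnS; split; first exact: add_ideal hK (scale_ideal x iL).
exists (addI K (scaleI x L1)); split; last by apply: IH => // v /hq /hs.
split; first by apply: addIS => // _ [r hr ->]; exists r => //; apply: hs.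
exists (x * u); split; first by apply: sub_addr => //; exists u.
move=> [k [_ [hk [[r hr ->] e]]]]; apply: h2.
have -> : u = (u - r) + r by ring.
apply: idlD => //; apply: hq; rewrite /quotI.
by have -> : x * (u - r) = k by rewrite mulrBr e; ring.
Qed.

(** A strict step from [K] to [L] stays strict either after adding [(x)] or after taking the colon
    by [x]: if [L + (x)] collapses to [K + (x)], an element of [L] outside [K] is [c + r x] with [c]
    in [K], and [r] separates the two colons. *)
Lemma chain_above_split K x k : chain_above k K ->
  exists m n, [/\ (k <= m + n)%N, chain_above m (addI K (prI x)) & chain_above n (quotI K x)].
Proof.
elim: k K => [|k IH] K hk; have hK := chain_above_ideal hk.
  by exists 0%N, 0%N; split=> //; split=> //; ideal.
have [_ [L [[hs [u [h1 h2]]] hL]]] := hk; have iL := chain_above_ideal hL.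
have [m [n [hmn hm hn]]] := IH L hL.
have iA : is_ideal (addI K (prI x)) by ideal.
have iQ : is_ideal (quotI K x) by ideal.
have sA : subset (addI K (prI x)) (addI L (prI x)) by apply: addIS.
have sQ : subset (quotI K x) (quotI L x) by move=> v; apply: hs.
have [h|h] := classic (subset (addI L (prI x)) (addI K (prI x))).
  exists m, n.+1; split; [by rewrite addnS|exact: chain_above_le hm|].
  split=> //; exists (quotI L x); split=> //; split=> //.
  have [c [_ [hc [[r ->] e]]]] := h u (sub_addl (pr_ideal x) h1).
  exists r; split.
    rewrite /quotI; have -> : x * r = u - c by rewrite e; ring.
    by apply: idlB => //; apply: hs.
  by move=> hr; apply: h2; rewrite e; apply: idlD => //; rewrite mulrC.
exists m.+1, n; split=> //; last exact: chain_above_le hn.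
split=> //; exists (addI L (prI x)); split=> //; split=> //.
by have [v [hv1 hv2]] := not_subset_ex h; exists v.
Qed.

(** This is additivity of length on the exact sequence from [R/(K : x)] by multiplication by [x] to
    [R/K], and on to [R/(K + (x))]. *)
Lemma len_add_quot K x : is_ideal K -> fin_length K ->
  len K = (len (addI K (prI x)) + len (quotI K x))%N.
Proof.
move=> hK hf; have [cK mK] := lenP hf.
have hA : fin_length (addI K (prI x)) by apply: (fin_length_le _ _ hf hK); [ideal|apply: sub_addl; ideal].
have hQ : fin_length (quotI K x).
  by apply: (fin_length_le _ _ hf hK); [ideal|move=> u; apply: idlM].
have [cA mA] := lenP hA; have [cQ mQ] := lenP hQ.
apply/eqP; rewrite eqn_leq mK ?andbT; last exact: chain_above_quot_add cA cQ.
have [m [n [hmn /mA hm /mQ hn]]] := chain_above_split x cK.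
by apply: leq_trans hmn _; apply: leq_add.
Qed.

Lemma chain_above_steps (V : nat -> R -> Prop) s n : (forall l, (l < s)%N -> is_ideal (V l)) ->
  (forall l, (l < s)%N -> strict_subset (V l) (V l.+1)) ->
  chain_above n (V s) -> chain_above (s + n) (V 0%N).
Proof.
elim: s V => [|s IH] V hi hs hn //.
rewrite addSn; split; first exact: hi.
exists (V 1%N); split; first exact: hs.
by apply: (IH (fun l => V l.+1)) => // l hl; [apply: hi|apply: hs].
Qed.
End Length.

(** * Powers of an ideal generated by a regular sequence, and forms regular on its graded ring *)

Section QuasiRegular.
Variable R : comNzRingType.
Implicit Types (Q : R -> Prop) (K : nat -> R -> Prop) (a b u v w x y z g h : R).

(** If [K] is the filtration by powers of an ideal, this is the filtration by powers of that ideal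
    enlarged by [x]; the head variable is split off, which suits induction on the degree. *)
Fixpoint adjoin x K (m : nat) : R -> Prop :=
  if m is m'.+1 then
    fun w => exists u v, adjoin x K m' u /\ K m'.+1 v /\ w = x * u + v
  else fun _ => True.

Definition filtration K :=
  [/\ forall m, is_ideal (K m), forall m, subset (K m.+1) (K m) &
      forall m n u v, K m u -> K n v -> K (m + n)%N (u * v)].

Definition trivial_filtration (m : nat) : R -> Prop :=
  if m is 0 then fun _ => True else @zeroI R.

Lemma trivial_filtrationP : filtration trivial_filtration.
Proof.
split.
- by case=> [|m]; [exact: full_ideal|exact: zero_ideal].
- by case=> [|m] u.
by case=> [|m] [|n] u v //= => [_ ->|->|->]; rewrite /zeroI ?mulr0 ?mul0r.
Qed.

Lemma adjoin_ideal x K m : filtration K -> is_ideal (adjoin x K m).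
Proof.
move=> [hi hS hM]; elim: m => [|m IH]; first exact: full_ideal.
split; first by exists 0, 0; rewrite mulr0 addr0; split; [exact: idl0|split=> //; exact: idl0].
split=> [_ _ [u [v [hu [hv ->]]]] [u' [v' [hu' [hv' ->]]]]|a _ [u [v [hu [hv ->]]]]].
  by exists (u + u'), (v + v'); split; [exact: idlD|split; [exact: idlD|ring]].
by exists (a * u), (a * v); split; [exact: idlM|split; [exact: idlM|ring]].
Qed.

Lemma sub_adjoin x K m : filtration K -> subset (K m) (adjoin x K m).
Proof.
case: m => [|m] // hK u hu; exists 0, u; rewrite mulr0 add0r; split=> //.
exact: idl0 (adjoin_ideal x m hK).
Qed.

Lemma adjoin_mul_head x K m u : filtration K -> adjoin x K m u -> adjoin x K m.+1 (x * u).
Proof. by move=> [hK _ _] hu; exists u, 0; rewrite addr0; do ![split=> //]; apply: idl0. Qed.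

Lemma adjoin_head x K : filtration K -> adjoin x K 1 x.
Proof. by move=> hK; have := @adjoin_mul_head x K 0 1 hK Logic.I; rewrite mulr1. Qed.

Lemma adjoin_filtration x K : filtration K -> filtration (adjoin x K).
Proof.
move=> hF; have hA m := adjoin_ideal x m hF; have [hK hS hM] := hF; split=> //.
  elim=> [|m IH] // _ [u [v [/IH hu [/hS hv ->]]]].
  by exists u, v.
have hKA m n u v : K m.+1 u -> adjoin x K n v -> adjoin x K (m.+1 + n)%N (u * v).
  move=> hu; elim: n v => [|n IH] v; rewrite ?addn0 ?addnS.
    by move=> _; apply: idlMr => //; apply: sub_adjoin.
  move=> [a [b [/IH ha [hb ->]]]]; exists (u * a), (u * b).
  by split=> //; split; [rewrite -addnS; apply: hM|ring].
elim=> [|m IH] n u v; first by rewrite add0n => _ hv; apply: idlM.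
move=> [a [b [ha [hb ->]]]] hv; rewrite mulrDl -mulrA; apply: idlD; first exact: hA.
  by rewrite addSn; apply: adjoin_mul_head => //; apply: IH.
exact: hKA.
Qed.

(** The nontrivial half of the equality of the intersection of [Q] and [K m] with their product. *)
Definition separated Q K := forall m u, K m u -> Q u -> prod_ideal Q (K m) u.

Lemma separated_trivial Q : separated Q trivial_filtration.
Proof.
case=> [|m] u hu hq; first by rewrite -[u]mulr1; apply: prod_mul.
by rewrite hu; exists [::]; rewrite big_nil.
Qed.

Lemma prod_addI_pr Q (L : R -> Prop) x u : is_ideal L -> prod_ideal (addI Q (prI x)) L u ->
  exists q d, [/\ prod_ideal Q L q, L d & u = q + x * d].
Proof.
move=> hL; have hP := prod_is_ideal Q hL; move: u; apply: prod_ind.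
- by exists 0, 0; rewrite mulr0 addr0; split=> //; exact: idl0.
- move=> _ _ [q [d [hq hd ->]]] [q' [d' [hq' hd' ->]]].
  by exists (q + q'), (d + d'); split; [exact: idlD|exact: idlD|ring].
move=> _ v [q [_ [hq [[r ->] ->]]]] hv; exists (q * v), (r * v).
by split; [exact: prod_mul|exact: idlM|ring].
Qed.

(** For [z a + b] in [Q], the element [b] lies in [Q + (z)], so separation rewrites it as [q + z d]
    with [q] in [Q K] and [d] in [K]. Then [z (a + d)] is in [Q], hence so is [a + d], to which
    induction on the degree applies. *)
Lemma separated_adjoin Q K z : is_ideal Q -> filtration K -> nzd Q z ->
  separated (addI Q (prI z)) K -> separated Q (adjoin z K).
Proof.
move=> hQ hF hz hs; have [hK _ _] := hF; have hA m := adjoin_ideal z m hF.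
elim=> [|m IH] u; first by move=> _ hu; rewrite -[u]mulr1; apply: prod_mul.
move=> [a [b [ha [hb ->]]]] hq.
have hb' : addI Q (prI z) b.
  exists (z * a + b), (z * - a); split=> //; split; [exact: prI_mul|ring].
have [q [d [h1 h2 e]]] := prod_addI_pr (hK _) (hs _ _ hb hb').
have hqQ : Q q by move: q h1 {e}; apply: prod_sub => // *; apply: idlMr.
have had : adjoin z K m (a + d).
  by apply: idlD => //; apply: sub_adjoin => //; have [_ hS _] := hF; apply: hS.
have /IH : Q (a + d).
  apply: hz; have -> : z * (a + d) = (z * a + b) - q by rewrite e; ring.
  exact: idlB.
move=> /(_ had) hp; have -> : z * a + b = z * (a + d) + q by rewrite e; ring.
have hP := prod_is_ideal Q (hA m.+1).
apply: idlD => //; last first.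
  move: q h1 {e hqQ}; apply: prod_sub => // v w hv hw.
  by apply: prod_mul => //; apply: sub_adjoin.
move: (a + d) hp; apply: (@prod_ind _ _ _ (fun s => prod_ideal Q (adjoin z K m.+1) (z * s))).
- by rewrite mulr0; exact: idl0.
- by move=> v w hv hw; rewrite mulrDr; apply: idlD.
by move=> v w hv hw; rewrite mulrCA; apply: prod_mul => //; apply: adjoin_mul_head.
Qed.

(** Multiplication by [g], seen as a form of degree [r], is injective on the graded ring that [K]
    induces on [R/Q]. *)
Definition cancels Q K (r : nat) g :=
  forall m w, addI (K (m + r)%N) Q (g * w) -> addI (K m) Q w.

Lemma cancelsM Q K r s g h : cancels Q K r g -> cancels Q K s h -> cancels Q K (r + s) (g * h).
Proof. by move=> hg hh m w; rewrite -mulrA (addnC r) addnA => /hg /hh. Qed.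

Lemma cancelsX Q K r g k : cancels Q K r g -> cancels Q K (r * k) (g ^+ k).
Proof.
move=> hg; elim: k => [|k IH]; last by rewrite exprS mulnS; apply: cancelsM.
by move=> m w; rewrite muln0 addn0 expr0 mul1r.
Qed.

(** Working modulo [y] first gives [w = w1 + q + s y] with [w1] of the right order and [q] in [Q].
    Multiplying by [g + y h] and cancelling [y] puts [s] under the induction hypothesis, one degree
    lower. *)
Lemma cancels_lift Q K r g y h : is_ideal Q -> filtration K -> K 0%N 1 ->
  K 1%N y -> cancels Q K 1 y -> K r g -> K r (y * h) ->
  cancels (addI Q (prI y)) K r g -> cancels Q K r (g + y * h).
Proof.
move=> hQ [hK hS hM] h1 hy hcy hg hyh hcg; elim=> [|m IH] w hw.
  by apply: sub_addl => //; rewrite -[w]mulr1; apply: idlM.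
have iA n : is_ideal (addI (K n) Q) by ideal.
have /hcg [w1 [_ [hw1 [[q [_ [hq [[s ->] ->]]]] ew]]]] :
    addI (K (m.+1 + r)%N) (addI Q (prI y)) (g * w).
  have [k [q [hk [hq e]]]] := hw; exists k, (q + (- (h * w)) * y).
  by split=> //; split; [exists q, (- (h * w) * y); split=> //; split=> //; exists (- (h * w))|
    rewrite addrA -e; ring].
have hs : addI (K m) Q s.
  apply: IH; apply: hcy; rewrite addn1 -addSn.
  have -> : y * ((g + y * h) * s) = (g + y * h) * w - ((g + y * h) * w1 + (g + y * h) * q).
    by rewrite ew; ring.
  apply: idlB => //; exists ((g + y * h) * w1), ((g + y * h) * q); split.
    by rewrite addnC; apply: hM => //; apply: idlD.
  by split=> //; apply: idlM.
have [k [q' [hk [hq' es]]]] := hs.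
exists (w1 + y * k), (q + y * q'); split; first by apply: idlD => //; exact: (hM 1%N).
by split; [apply: idlD => //; exact: idlM|rewrite ew es; ring].
Qed.

Lemma cancels_head Q K x : is_ideal Q -> filtration K -> nzd Q x ->
  separated (addI Q (prI x)) K -> cancels Q (adjoin x K) 1 x.
Proof.
move=> hQ hF hx hs m w; rewrite addn1 => -[_ [q [[a [b [ha [hb ->]]]] [hq e]]]].
have [hK hS _] := hF.
have hb' : addI Q (prI x) b.
  exists (- q), (x * (w - a)); split; first exact: idlN.
  split; [exact: prI_mul|rewrite mulrBr e; ring].
have [q' [d [h1 h2 eb]]] := prod_addI_pr (hK _) (hs _ _ hb hb').
have hqQ : Q q' by move: q' h1 {eb}; apply: prod_sub => // *; apply: idlMr.
have hd : Q (w - a - d).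
  apply: hx; have -> : x * (w - a - d) = q' + q by rewrite !mulrBr e eb; ring.
  exact: idlD.
exists (a + d), (w - a - d); split; last by split=> //; ring.
apply: idlD => //; first exact: adjoin_ideal.
by apply: sub_adjoin => //; apply: hS.
Qed.

Lemma adjoin_sub_addI Q K x n : is_ideal Q -> filtration K -> K 0%N 1 -> Q x ->
  subset (adjoin x K n) (addI (K n) Q).
Proof.
move=> hQ [hK _ _] h1 hx; case: n => [|n] u.
  by move=> _; apply: sub_addl => //; rewrite -[u]mulr1; apply: idlM.
move=> [a [b [_ [hb ->]]]]; exists b, (x * a).
by split=> //; split; [exact: idlMr|ring].
Qed.

(** Adjoining an element that already lies in [Q] does not change the filtration modulo [Q]. *)
Lemma cancels_adjoin Q K x r g : is_ideal Q -> filtration K -> K 0%N 1 -> Q x ->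
  cancels Q K r g -> cancels Q (adjoin x K) r g.
Proof.
move=> hQ hF h1 hx hc m w hw; have [hK _ _] := hF.
have /hc : addI (K (m + r)%N) Q (g * w).
  move: hw; apply: addI_sub; [by ideal|exact: adjoin_sub_addI|by apply: sub_addr].
by apply: addIS => //; apply: sub_adjoin.
Qed.

Section ThreeElements.
Variables x y z : R.
Let Q1 := addI (@zeroI R) (prI x).
Let Q2 := addI Q1 (prI y).

(** The term of degree [m] is the [m]-th power of the ideal generated by [x], [y], [z]. *)
Definition triple_powers := adjoin x (adjoin y (adjoin z trivial_filtration)).

Lemma triple_powers_filtration : filtration triple_powers.
Proof. by do !apply: adjoin_filtration; apply: trivial_filtrationP. Qed.

Lemma triple_powers_x : triple_powers 1 x.
Proof. by apply: adjoin_head; do !apply: adjoin_filtration; apply: trivial_filtrationP. Qed.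
Lemma triple_powers_y : triple_powers 1 y.
Proof.
have h := adjoin_filtration z trivial_filtrationP.
by apply: sub_adjoin; [exact: adjoin_filtration|exact: adjoin_head].
Qed.
Lemma triple_powers_z : triple_powers 1 z.
Proof.
have h := adjoin_filtration z trivial_filtrationP.
apply: sub_adjoin; first exact: adjoin_filtration.
by apply: sub_adjoin => //; apply: adjoin_head; apply: trivial_filtrationP.
Qed.

Lemma triple_powersX k u : triple_powers 1 u -> triple_powers k (u ^+ k).
Proof.
have [_ _ hM] := triple_powers_filtration.
move=> hu; elim: k => [|k IH] //; rewrite exprS; exact: (hM 1%N).
Qed.

Hypotheses (hx : nzd (@zeroI R) x) (hy : nzd Q1 y) (hz : nzd Q2 z).

(* Modulo the earlier elements, the leading monomial of the form is the only one left. *)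
Lemma cancels_lex_form al be ga h h' : triple_powers ga h' -> triple_powers (be + ga) h ->
  cancels (@zeroI R) triple_powers (al + (be + ga.+1))
    (x ^+ al * (y ^+ be * (z ^+ ga.+1 + y * h') + x * h)).
Proof.
move=> hh' hh; have hF := triple_powers_filtration; have [hK hS hM] := hF.
have F0 := trivial_filtrationP; have F1 := adjoin_filtration z F0.
have F2 := adjoin_filtration y F1.
have iQ1 : is_ideal Q1 by rewrite /Q1; ideal.
have iQ2 : is_ideal Q2 by rewrite /Q2; ideal.
have i0 := zero_ideal R.
have Q1x : Q1 x by apply: sub_addr => //; exact: prI_self.
have Q2x : Q2 x by apply: sub_addl => //; exact: pr_ideal.
have Q2y : Q2 y by apply: sub_addr => //; exact: prI_self.
have s1 : separated Q2 (adjoin z trivial_filtration).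
  by apply: separated_adjoin => //; apply: separated_trivial.
have s2 : separated Q1 (adjoin y (adjoin z trivial_filtration)) by apply: separated_adjoin.
have cx : cancels (@zeroI R) triple_powers 1 x by apply: cancels_head.
have cy : cancels Q1 triple_powers 1 y.
  by apply: cancels_adjoin => //; apply: cancels_head.
have cz : cancels Q2 triple_powers 1 z.
  apply: cancels_adjoin => //; apply: cancels_adjoin => //.
  by apply: cancels_head => //; apply: separated_trivial.
have X1 := triple_powers_x; have Y1 := triple_powers_y; have Z1 := triple_powers_z.
apply: cancelsM; first by have := cancelsX (k := al) cx; rewrite mul1n.
have g1 : triple_powers ga.+1 (z ^+ ga.+1 + y * h').
  by apply: idlD => //; [exact: triple_powersX|exact: (hM 1%N)].
apply: cancels_lift => //.
- by apply: hM => //; apply: triple_powersX.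
- by rewrite addnS; apply: (hM 1%N).
apply: cancelsM; first by have := cancelsX (k := be) cy; rewrite mul1n.
apply: cancels_lift => //; first exact: triple_powersX.
- exact: (hM 1%N).
by have := cancelsX (k := ga.+1) cz; rewrite mul1n.
Qed.
End ThreeElements.
End QuasiRegular.

(** * Orders of the powers of [a], from a relation [a y^k = b + x c] *)

Section OrderOfPowers.
Variable R : comNzRingType.
Variables (I : R -> Prop) (x y : R) (n0 : nat).
Hypotheses (Ix : I x) (Iy : I y).
Hypothesis cancel_x : forall n w, (n0 <= n)%N -> ideal_pow I n.+1 (x * w) -> ideal_pow I n w.
Hypothesis cancel_y : forall n w, (n0 <= n)%N ->
  addI (ideal_pow I n.+1) (prI x) (y * w) -> addI (ideal_pow I n) (prI x) w.

Let iP n : is_ideal (ideal_pow I n). Proof. exact: pow_ideal. Qed.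

Lemma cancel_xX j n w : (n0 <= n)%N -> ideal_pow I (n + j) (x ^+ j * w) -> ideal_pow I n w.
Proof.
move=> hn; elim: j w => [|j IH] w; first by rewrite expr0 mul1r addn0.
rewrite exprS -mulrA addnS => /cancel_x h; apply: IH; apply: h.
exact: leq_trans hn (leq_addr _ _).
Qed.

(** Cancelling [y] modulo [x] writes [w = w' + x w1]; cancelling [x] then gives the same hypothesis
    for [w1] modulo [x^i], one degree lower. This is why the threshold grows with [i]. *)
Lemma cancel_y_mod_xX i m w : (n0 + i <= m)%N ->
  addI (ideal_pow I m.+1) (prI (x ^+ i)) (y * w) -> addI (ideal_pow I m) (prI (x ^+ i)) w.
Proof.
elim: i m w => [|i IH] m w hm hw.
  by apply: sub_addr => //; exists w; rewrite expr0 mulr1.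
have n0m : (n0 <= m)%N by apply: leq_trans hm; apply: leq_addr.
have /(cancel_y n0m) [w' [_ [hw' [[w1 ->] ew]]]] : addI (ideal_pow I m.+1) (prI x) (y * w).
  move: hw; apply: addIS => // _ [r ->]; by rewrite exprSr mulrA; exists (r * x ^+ i).
case: m hm n0m hw hw' => [|m] hm n0m hw hw'; first by rewrite addnS in hm.
have [g [_ [hg [[h ->] e]]]] := hw.
suff [g' [_ [hg' [[h' ->] e']]]] : addI (ideal_pow I m) (prI (x ^+ i)) w1.
  exists (w' + x * g'), (h' * x ^+ i.+1); split; first by apply: idlD => //; exact: powS.
  by split; [exists h'|rewrite ew e' exprS; ring].
apply: IH; first by rewrite addnS ltnS in hm.
exists (y * w1 - h * x ^+ i), (h * x ^+ i); split; last by split; [exists h|ring].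
apply: cancel_x => //.
have -> : x * (y * w1 - h * x ^+ i) = g - y * w'.
  have -> : g = y * w - h * x ^+ i.+1 by rewrite e; ring.
  by rewrite ew exprS; ring.
by apply: idlB => //; exact: powS.
Qed.

Lemma cancel_yX_mod_xX j i m w : (n0 + i <= m)%N ->
  addI (ideal_pow I (m + j)) (prI (x ^+ i)) (y ^+ j * w) -> addI (ideal_pow I m) (prI (x ^+ i)) w.
Proof.
move=> hm; elim: j w => [|j IH] w; first by rewrite expr0 mul1r addn0.
rewrite exprS -mulrA addnS => /cancel_y_mod_xX h; apply: IH; apply: h.
exact: leq_trans hm (leq_addr _ _).
Qed.

Variables (a b c : R) (k : nat).
Hypotheses (hk : (n0 < k)%N) (hb : ideal_pow I k.+1 b) (eabc : a * y ^+ k = b + x * c).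

(** Expand [(x c)^i = (a y^k - b)^i]: every term has order at least [k i + (i - D)], since [b] gains
    one degree over [y^k]. Cancelling [x^i] costs [i] degrees. *)
Lemma cofactor_power_order D i : (0 < i)%N -> (forall l, (l <= i)%N -> ideal_pow I (l - D) (a ^+ l)) ->
  ideal_pow I (k.-1 * i + (i - D)) (c ^+ i).
Proof.
move=> i0 ha; apply: (@cancel_xX i).
  by apply: leq_trans (leq_addr _ _); rewrite -[n0]muln1 leq_mul //; lia.
rewrite -exprMn; have -> : x * c = a * y ^+ k + - b by rewrite eabc; ring.
rewrite exprDn; apply: idl_sum => // j _; apply: idlMn => //.
have hj : (j <= i)%N by rewrite -ltnS.
have h1 : ideal_pow I (i - j - D + k * (i - j)) ((a * y ^+ k) ^+ (i - j)).
  rewrite exprMn -exprM; apply: powM; first by apply: ha; apply: leq_subr.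
  exact: pow1X.
have h2 : ideal_pow I (k.+1 * j) ((- b) ^+ j) by apply: powX; apply: idlN.
by apply: pow_le (powM h1 h2); case: k hk => // k' _; rewrite succnK; nia.
Qed.

(** Expand [(a y^k)^N = (b + x c)^N]. Terms with at least [i0] factors [x c] vanish modulo [x^i0];
    the others are bounded by the orders of [c^i]. Then [y^(k N)] is cancelled. *)
Lemma power_order_mod_xX D i0 N : (i0 + D + n0 <= N)%N ->
  (forall l, (l < i0)%N -> ideal_pow I (l - D) (a ^+ l)) ->
  addI (ideal_pow I (N - D)) (prI (x ^+ i0)) (a ^+ N).
Proof.
move=> hN ha; apply: (@cancel_yX_mod_xX (k * N)%N); first lia.
have iA : is_ideal (addI (ideal_pow I (N - D + k * N)) (prI (x ^+ i0))) by ideal.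
have -> : y ^+ (k * N) * a ^+ N = (b + x * c) ^+ N by rewrite -eabc exprMn -exprM mulrC.
rewrite exprDn; apply: idl_sum => // i _; apply: idlMn => //.
have hi : (i <= N)%N by rewrite -ltnS.
have [hii|hii] := ltnP i i0; last first.
  apply: idlM => //; apply: sub_addr => //; rewrite -(subnK hii) exprMn exprD.
  by exists (x ^+ (i - i0) * c ^+ (i - i0 + i0)); ring.
apply: sub_addl; first exact: pr_ideal.
have h1 : ideal_pow I (k.+1 * (N - i)) (b ^+ (N - i)) by apply: powX.
(* The term with [i = 0] is treated apart: the order bound on [c^i] needs [i > 0] to reach the
   threshold for cancelling [x]. *)
have [i_gt0|] := ltnP 0 i; last first.
  rewrite leqn0 => /eqP i_0; rewrite i_0 expr0 mulr1; rewrite i_0 in h1.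
  by apply: pow_le h1; lia.
have h2 := cofactor_power_order i_gt0 (fun l hl => ha l (leq_ltn_trans hl hii)).
have h3 := pow1X i Ix; rewrite exprMn.
by apply: pow_le (powM h1 (powM h3 h2)); case: k hk => // k' _; rewrite succnK; nia.
Qed.

Lemma power_order_step D i0 : (forall l, (l < i0)%N -> ideal_pow I (l - D) (a ^+ l)) ->
  ideal_pow I i0 (a ^+ (i0 + D + n0)).
Proof.
move=> /(power_order_mod_xX (leqnn _)) h; move: (a ^+ _) h.
apply: addI_sub => //; first by apply: pow_le; lia.
by apply: pr_sub => //; apply: pow1X.
Qed.

(** One more unit of [s] loses only [n0] further degrees but enlarges the range of exponents
    quadratically. The step is applied with [D = s n0] and [i0 = l - (s + 1) n0], whose sum with
    [n0] is [l]. *)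
Lemma power_order_sqrt s l : (l.*2 <= n0 * s * s)%N -> ideal_pow I (l - s * n0) (a ^+ l).
Proof.
elim: s l => [|s IH] l hl; first by have -> : l = 0%N by lia.
have [h|h] := leqP l (s.+1 * n0); first by have -> : (l - s.+1 * n0 = 0)%N by lia.
have := @power_order_step (s * n0) (l - s.+1 * n0).
have -> : (l - s.+1 * n0 + s * n0 + n0 = l)%N by rewrite mulSn; lia.
by apply=> l' hl'; apply: IH; nia.
Qed.
End OrderOfPowers.

(** * Adding elements one at a time: a linear relation or a long chain *)

Section Staircase.
Variable R : comNzRingType.
Implicit Types (K : R -> Prop) (u : nat -> R).

Fixpoint adjoin_seq K u (l : nat) : R -> Prop :=
  if l is l'.+1 then addI (adjoin_seq K u l') (prI (u l')) else K.

Lemma adjoin_seq_ideal K u l : is_ideal K -> is_ideal (adjoin_seq K u l).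
Proof. by move=> hK; elim: l => [|l IH] //=; ideal. Qed.

Lemma adjoin_seq_sum K u l w : adjoin_seq K u l w ->
  exists r : nat -> R, K (w - \sum_(j < l) r j * u j).
Proof.
elim: l w => [|l IH] w; first by exists (fun _ => 0); rewrite big_ord0 subr0.
move=> [v [_ [/IH [r hr] [[s ->] ->]]]].
exists (fun j => if j == l then s else r j); rewrite big_ord_recr /= eqxx.
rewrite (eq_bigr (fun j : 'I_l => r j * u j)); last by move=> j _; rewrite ltn_eqF.
by have -> : v + s * u l - (\sum_(j < l) r j * u j + s * u l) = v - \sum_(j < l) r j * u j by ring.
Qed.

(** Either some [u l] already belongs to the ideal generated by [K] and its predecessors, or each
    addition is a strict inclusion. *)
Lemma adjoin_seq_dichotomy K u s : is_ideal K ->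
  (exists l (r : nat -> R), (l < s)%N /\ K (u l - \sum_(j < l) r j * u j)) \/
  (forall n, chain_above n (adjoin_seq K u s) -> chain_above (s + n) K).
Proof.
move=> hK; have [[l [hl /adjoin_seq_sum [r hr]]]|h] :=
  classic (exists l, (l < s)%N /\ adjoin_seq K u l (u l)); first by left; exists l, r.
right=> n; apply: (chain_above_steps (V := adjoin_seq K u)) => [l _|l hl].
  exact: adjoin_seq_ideal.
split; first by apply: sub_addl; exact: pr_ideal.
exists (u l); split; last by move=> hn; apply: h; exists l.
by apply: sub_addr; [exact: adjoin_seq_ideal|exact: prI_self].
Qed.
End Staircase.

(** * From a square-root loss to a bounded loss of order, by counting lengths *)

Section Reduction.
Variable R : comNzRingType.
Variables (I : R -> Prop) (a : R).

(* The degree [T] piece of the Rees module generated by [1, ..., a^j]. *)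
Fixpoint pow_span (j T : nat) : R -> Prop :=
  if j is j'.+1 then addI (pow_span j' T) (scaleI (a ^+ j'.+1) (ideal_pow I (T - j'.+1)))
  else ideal_pow I T.

Lemma pow_span_ideal j T : is_ideal (pow_span j T).
Proof.
elim: j => [|j IH] /=; first exact: pow_ideal.
by apply: add_ideal => //; apply: scale_ideal; apply: pow_ideal.
Qed.

Lemma pow_spanS j T : subset (pow_span j T) (pow_span j.+1 T).
Proof. by apply: sub_addl; apply: scale_ideal; apply: pow_ideal. Qed.

Lemma pow_span_mem j T l v : (l <= j)%N -> ideal_pow I (T - l) v -> pow_span j T (a ^+ l * v).
Proof.
elim: j => [|j IH]; first by rewrite leqn0 => /eqP ->; rewrite subn0 expr0 mul1r.
rewrite leq_eqVlt => /orP[/eqP -> hv|hl hv]; last by apply: pow_spanS; apply: IH.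
by apply: sub_addr; [apply: pow_span_ideal|exists v].
Qed.

Lemma pow_span_sub j T (K : R -> Prop) : is_ideal K ->
  (forall l v, (l <= j)%N -> ideal_pow I (T - l) v -> K (a ^+ l * v)) -> subset (pow_span j T) K.
Proof.
move=> hK; elim: j => [|j IH] h /=.
  by move=> v hv; rewrite -[v]mul1r -(expr0 a); apply: h => //; rewrite subn0.
apply: addI_sub => //; first by apply: IH => l v hl; apply: h; apply: leqW.
by move=> _ [v hv ->]; apply: h.
Qed.

Lemma pow_span_bound r j T : (forall l, (l <= j)%N -> ideal_pow I (l - r) (a ^+ l)) ->
  subset (pow_span j T) (ideal_pow I (T - r)).
Proof.
move=> ha; apply: pow_span_sub => [|l v hl hv]; first exact: pow_ideal.
by apply: pow_le (powM (ha l hl) hv); lia.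
Qed.

(** Multiplication by [f a] maps [pow_span i] into itself with degree raised by [d + 1]: the
    generators [a^l] with [l < i] move up by one, and [a^i] is brought back by the given
    relation. *)
Lemma pow_span_iter i d f t : ideal_pow I d f -> pow_span i (i.+1 + d) (f * a ^+ i.+1) ->
  pow_span i (i + t + d * t) (f ^+ t * a ^+ (i + t)).
Proof.
move=> hf hfa; elim: t => [|t IH].
  rewrite !addn0 muln0 addn0 expr0 mul1r -[a ^+ i]mulr1; apply: pow_span_mem => //.
  by rewrite subnn.
have -> : f ^+ t.+1 * a ^+ (i + t.+1) = (f * a) * (f ^+ t * a ^+ (i + t)).
  by rewrite addnS !exprS; ring.
have iT := pow_span_ideal i (i + t.+1 + d * t.+1).
move: (f ^+ t * _) IH.
suff h : subset (pow_span i (i + t + d * t)) (quotI (pow_span i (i + t.+1 + d * t.+1)) (f * a)).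
  by move=> w /h.
apply: pow_span_sub => [|l v hl hv]; first by ideal.
rewrite /quotI; move: hl; rewrite leq_eqVlt => /orP[/eqP e|hl].
  have -> : f * a * (a ^+ l * v) = f * a ^+ i.+1 * v by rewrite e exprS; ring.
  rewrite mulrC; move: (f * _) hfa.
  suff h : subset (pow_span i (i.+1 + d)) (quotI (pow_span i (i + t.+1 + d * t.+1)) v).
    by move=> w /h.
  apply: pow_span_sub => [|l' v' hl' hv']; first by ideal.
  rewrite /quotI mulrCA; apply: pow_span_mem => //.
  by apply: pow_le (powM hv hv'); nia.
have -> : f * a * (a ^+ l * v) = a ^+ l.+1 * (f * v) by rewrite exprS; ring.
apply: pow_span_mem => //; apply: pow_le (powM hf hv); nia.
Qed.

Variables (x y z : R).
Hypotheses (Ix : I x) (Iy : I y) (Iz : I z).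
Hypotheses (hx : nzd (@zeroI R) x) (hy : nzd (addI (@zeroI R) (prI x)) y)
  (hz : nzd (addI (addI (@zeroI R) (prI x)) (prI y)) z).

Let J := triple_powers x y z.

Lemma adjoin_pow w (K : nat -> R -> Prop) : I w -> (forall m, subset (K m) (ideal_pow I m)) ->
  forall m, subset (adjoin w K m) (ideal_pow I m).
Proof.
move=> Iw hK; elim=> [|m IH] // _ [u [v [hu [hv ->]]]].
by apply: idlD; [exact: pow_ideal|apply: powS => //; apply: IH|apply: hK].
Qed.

Lemma triple_powers_pow m : subset (J m) (ideal_pow I m).
Proof.
move: m; do 3!apply: adjoin_pow => //.
by case=> [|m] // _ ->; apply: idl0; apply: pow_ideal.
Qed.

(** For [j < rho^2] this lists, in decreasing lexicographic order, the monomials of degree [d] whose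
    exponents in [x] and [y] are below [rho]; [z] takes the remaining degree. *)
Definition lex_mon rho d j : R :=
  let al := (rho.-1 - j %/ rho)%N in let be := (rho.-1 - j %% rho)%N in
  x ^+ al * (y ^+ be * z ^+ (d - al - be)).

Lemma triple_powers_mon al be ga : J (al + (be + ga)) (x ^+ al * (y ^+ be * z ^+ ga)).
Proof.
have [_ _ hM] := triple_powers_filtration x y z.
apply: (hM); first by apply: triple_powersX; apply: triple_powers_x.
by apply: (hM); apply: triple_powersX; [exact: triple_powers_y|exact: triple_powers_z].
Qed.

(** Each earlier monomial is lexicographically larger, hence divisible by [x^(al+1)] or by
    [x^al y^(be+1)]. The difference thus has the shape treated in [cancels_lex_form], with leading
    coefficient 1. *)
Lemma lex_mon_cancels rho d l (r : nat -> R) : (l < rho * rho)%N -> (rho.*2 <= d)%N ->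
  let f := lex_mon rho d l - \sum_(j < l) r j * lex_mon rho d j in
  cancels (@zeroI R) J d f /\ J d f.
Proof.
move=> hl hd f.
have rho0 : (0 < rho)%N by case: rho hl {hd f}.
have hJ := triple_powers_filtration x y z; have [iJ _ hM] := hJ.
have lt_rho q : (rho.-1 - q < rho)%N by apply: leq_ltn_trans (leq_subr _ _) _; rewrite ltn_predL.
set al := (rho.-1 - l %/ rho)%N; set be := (rho.-1 - l %% rho)%N.
have hal : (al < rho)%N by apply: lt_rho.
have hbe : (be < rho)%N by apply: lt_rho.
(* The bound [rho.*2 <= d] leaves a positive exponent for [z]. *)
pose ga := (d - al - be).-1.
have ega : (d - al - be = ga.+1)%N by rewrite /ga; lia.
have ed : (d = al + (be + ga.+1))%N by lia.
pose M w := exists h h', [/\ J (be + ga) h, J ga h' & w = x ^+ al * (y ^+ be * (y * h') + x * h)].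
have iM : is_ideal M.
  split; first by exists 0, 0; split; [exact: idl0|exact: idl0|ring].
  split=> [_ _ [h [h' [hh hh' ->]]] [k [k' [hk hk' ->]]]|c _ [h [h' [hh hh' ->]]]].
    by exists (h + k), (h' + k'); split; [exact: idlD|exact: idlD|ring].
  by exists (c * h), (c * h'); split; [exact: idlM|exact: idlM|ring].
have hmon j : (j < l)%N -> M (lex_mon rho d j).
  move=> hj; rewrite /lex_mon.
  set al' := (rho.-1 - j %/ rho)%N; set be' := (rho.-1 - j %% rho)%N.
  have hal' : (al' < rho)%N by apply: lt_rho.
  have hbe' : (be' < rho)%N by apply: lt_rho.
  have hlex : (al < al')%N \/ al' = al /\ (be < be')%N.
    have e1 := divn_eq j rho; have e2 := divn_eq l rho.
    have m1 := ltn_pmod j rho0; have m2 := ltn_pmod l rho0.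
    have d2 : (l %/ rho < rho)%N by rewrite ltn_divLR.
    have d1 : (j %/ rho <= l %/ rho)%N by apply: leq_div2r; apply: ltnW.
    rewrite /al /al' /be /be'; move: d1; rewrite leq_eqVlt => /orP[/eqP d1|d1]; last by left; lia.
    by right; split; [lia|rewrite d1 in e1; lia].
  clearbody al' be' al be ga; clear hl hj lt_rho; case: hlex => [h|[h1 h2]].
  - exists (x ^+ (al' - al.+1) * (y ^+ be' * z ^+ (d - al' - be'))), 0; split.
    + have -> : (be + ga = al' - al.+1 + (be' + (d - al' - be')))%N by lia.
      exact: triple_powers_mon.
    + exact: idl0.
    by rewrite -{1}(subnKC h) exprD exprS; ring.
  exists 0, (x ^+ 0 * (y ^+ (be' - be.+1) * z ^+ (d - al' - be'))); split.
  + exact: idl0.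
  + have -> : (ga = 0 + (be' - be.+1 + (d - al' - be')))%N by lia.
    exact: triple_powers_mon.
  by rewrite h1 -{1}(subnKC h2) exprD exprS; ring.
have [h [h' [hh hh' e]]] : M (- \sum_(j < l) r j * lex_mon rho d j).
  by apply: idlN => //; apply: idl_sum => // j _; apply: idlM => //; apply: hmon.
have ef : f = x ^+ al * (y ^+ be * (z ^+ ga.+1 + y * h') + x * h).
  by rewrite /f e /lex_mon -/al -/be ega; ring.
rewrite ef ed; split; first exact: cancels_lex_form.
apply: (hM); first by apply: triple_powersX; apply: triple_powers_x.
have x1 := triple_powers_x x y z; have y1 := triple_powers_y x y z.
have z1 := triple_powers_z x y z.
apply: idlD => //; last by rewrite addnS; apply: (hM 1%N).
apply: (hM); first exact: triple_powersX.
by apply: idlD => //; [exact: triple_powersX|apply: (hM 1%N)].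
Qed.

Variables (n0 n1 N c : nat).
Hypothesis red : forall m, subset (ideal_pow I (n1 + m)) (J m).
Hypothesis fin : forall n, (N <= n)%N -> fin_length (ideal_pow I n).
Hypothesis growth : forall r T, (N <= T - r)%N -> (r <= T)%N ->
  (len (ideal_pow I T) <= len (ideal_pow I (T - r)) + r * (c * T * T))%N.
Hypothesis order : forall s l, (l.*2 <= n0 * s * s)%N -> ideal_pow I (l - s * n0) (a ^+ l).

(** Without a relation, each passage from [pow_span i T] to [pow_span i.+1 T] gains [j^2] in length.
    Then [I^T] has colength at least [j^3] more than [I^(T - r)], which exceeds what [growth]
    allows. *)
Lemma exists_cancelling_relation : (0 < n0)%N -> exists i d f,
  [/\ cancels (@zeroI R) J d f, J d f & pow_span i (i.+1 + d) (f * a ^+ i.+1)].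
Proof.
(* The bound [order] at [2 s] covers all exponents up to [j], with loss [r]. As [j = 2 n0 s^2] and
   [r = 2 n0 s], the final inequality [j <= 9 r c] would force [s <= 9 c]. The summand [N] ensures
   [N <= T - r], and [T = 3 j] keeps the degrees [T - i - 1] at least [2 j]. *)
move=> n0_gt0; pose s := (9 * c + N).+1; pose j := (n0 * s * s).*2; pose r := (s.*2 * n0)%N.
pose T := (3 * j)%N; apply: NNPP => hn.
have hj0 : (0 < j)%N by rewrite /j; nia.
have step i : (i < j)%N -> forall n, chain_above n (pow_span i.+1 T) ->
    chain_above (j * j + n) (pow_span i T).
  move=> hi n hc; pose u l := lex_mon j (T - i.+1) l * a ^+ i.+1.
  have [[l [q [hl hq]]]|h] := adjoin_seq_dichotomy u (j * j) (pow_span_ideal i T).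
    case: hn; exists i, (T - i.+1)%N, (lex_mon j (T - i.+1) l - \sum_(j0 < l) q j0 * lex_mon j (T - i.+1) j0).
    have hd : (j.*2 <= T - i.+1)%N by rewrite /T; lia.
    have [h1 h2] := lex_mon_cancels q hl hd; split=> //.
    rewrite subnKC; last by rewrite /T; lia.
    move: hq; rewrite /u mulrBl mulr_suml; congr (pow_span _ _ (_ - _)).
    by apply: eq_bigr => k _; rewrite mulrA.
  apply: h; apply: chain_above_le hc; first by apply: adjoin_seq_ideal; apply: pow_span_ideal.
  elim: (j * j)%N => [|l IH] /=; first exact: pow_spanS.
  apply: addI_sub => //; first exact: (pow_span_ideal i.+1).
  apply: pr_sub; first exact: (pow_span_ideal i.+1).
  apply: sub_addr; first exact: pow_span_ideal.
  exists (lex_mon j (T - i.+1) l); last by rewrite mulrC.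
  apply: triple_powers_pow; rewrite /lex_mon.
  set al := (_ - _ %/ _)%N; set be := (_ - _ %% _)%N.
  have hal : (al < j)%N by apply: leq_ltn_trans (leq_subr _ _) _; rewrite ltn_predL.
  have hbe : (be < j)%N by apply: leq_ltn_trans (leq_subr _ _) _; rewrite ltn_predL.
  have {1}-> : (T - i.+1 = al + (be + (T - i.+1 - al - be)))%N by rewrite /T; lia.
  exact: triple_powers_mon.
have chain n : chain_above n (pow_span j T) -> chain_above (j * (j * j) + n) (ideal_pow I T).
  have : (j <= j)%N by [].
  elim: {1 3 4}j n => [|i IH] n hi //.
  move/(step _ hi) => /(IH _ (ltnW hi)); congr (chain_above _ _).
  by rewrite mulSn; lia.
have hrj : (r <= j)%N by rewrite /r /j /s; nia.
have hTr : (N <= T - r)%N by rewrite /T; apply: leq_trans (_ : 2 * j <= _)%N; [rewrite /j /s; nia|lia].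
have hsub : subset (pow_span j T) (ideal_pow I (T - r)).
  by apply: pow_span_bound => l hl; apply: order; rewrite /j in hl; nia.
have hT : (N <= T)%N by apply: leq_trans hTr (leq_subr _ _).
have [cr _] := lenP (fin hTr); have [_ mT] := lenP (fin hT).
have /chain /mT h1 := chain_above_le (pow_span_ideal j T) hsub cr.
have h2 := growth hTr (_ : (r <= T)%N).
have {h2} : (j * (j * j) <= r * (c * T * T))%N.
  by rewrite -(leq_add2r (len (ideal_pow I (T - r)))) (leq_trans h1) // addnC h2 //; rewrite /T; lia.
have -> : (r * (c * T * T) = (9 * r * c) * (j * j))%N by rewrite /T; ring.
rewrite leq_pmul2r; last by rewrite muln_gt0 hj0.
by rewrite /j /r /s; nia.
Qed.

(** Iterating the relation puts [f^t a^l] in [I^(t + d t)], hence in the power of [(x, y, z)] of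
    exponent [t - n1 + d t]. Cancelling [f^t] removes exactly the [d t] degrees. *)
Lemma power_order_bounded : (0 < n0)%N -> exists C, forall l, ideal_pow I (l - C) (a ^+ l).
Proof.
move=> /exists_cancelling_relation [i [d [f [hc hf hfa]]]].
have [iJ _ _] := triple_powers_filtration x y z.
exists (i + n1)%N => l; have [h|h] := leqP l (i + n1).
  by have -> : (l - (i + n1) = 0)%N by lia.
pose t := (l - i)%N; have el : l = (i + t)%N by rewrite /t; lia.
have hfI : ideal_pow I d f by apply: triple_powers_pow.
have h1 := pow_span_iter t hfI hfa.
have hb : ideal_pow I (n1 + (t - n1 + d * t)) (f ^+ t * a ^+ l).
  have h0 l' : (l' <= i)%N -> ideal_pow I (l' - i) (a ^+ l').
    by move=> hl'; have -> : (l' - i = 0)%N by lia.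
  by have := pow_span_bound h0 h1; rewrite el; apply: pow_le; nia.
apply: triple_powers_pow.
have [] : addI (J (l - (i + n1))%N) (@zeroI R) (a ^+ l).
  apply: (cancelsX (k := t) hc); apply: sub_addl; first exact: zero_ideal.
  have -> : (l - (i + n1) = t - n1)%N by rewrite /t; lia.
  exact: red.
by move=> u [v [hu [-> ->]]]; rewrite addr0.
Qed.
End Reduction.

(** * Noetherian rings and Hilbert's basis theorem *)

Lemma chain_le (A : comNzRingType) (C : nat -> A -> Prop) m n : (forall k, subset (C k) (C k.+1)) ->
  (m <= n)%N -> subset (C m) (C n).
Proof.
move=> h /subnKC <-; elim: (n - m)%N => [|k IH] u; first by rewrite addn0.
by rewrite addnS => /IH /h.
Qed.

Section Noetherian.
Variable A : comNzRingType.
Implicit Types (K L P : A -> Prop).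

Lemma gen_ideal_nil (w : A) : gen_ideal [::] w <-> w = 0.
Proof.
split=> [[c [_ ->]]|->]; first by rewrite big_ord0.
by exists [::]; rewrite big_ord0.
Qed.

Lemma gen_ideal_cons (a : A) s w : gen_ideal (a :: s) w <-> exists r v, gen_ideal s v /\ w = r * a + v.
Proof.
split=> [[[|r c] [//= [hc] ->]]|[r [_ [[c [hc ->]] ->]]]].
  by exists r, (\sum_(i < size s) c`_i * s`_i); split; [exists c|rewrite big_ord_recl].
by exists (r :: c); rewrite /= hc big_ord_recl.
Qed.

Lemma gen_idealP (s : seq A) : is_ideal (gen_ideal s).
Proof.
elim: s => [|a s IH].
  split; first by apply/gen_ideal_nil.
  split=> [u v /gen_ideal_nil -> /gen_ideal_nil ->|u v /gen_ideal_nil ->];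
  by apply/gen_ideal_nil; rewrite ?addr0 ?mulr0.
split; first by apply/gen_ideal_cons; exists 0, 0; split; [exact: idl0|ring].
split=> [_ _ /gen_ideal_cons [r [v [hv ->]]] /gen_ideal_cons [r' [v' [hv' ->]]]
        |c _ /gen_ideal_cons [r [v [hv ->]]]];
apply/gen_ideal_cons.
  by exists (r + r'), (v + v'); split; [exact: idlD|ring].
by exists (c * r), (c * v); split; [exact: idlM|ring].
Qed.

Lemma gen_ideal_mem (s : seq A) a : a \in s -> gen_ideal s a.
Proof.
elim: s => // b s IH; rewrite inE => /orP[/eqP ->|/IH h]; apply/gen_ideal_cons.
  by exists 1, 0; split; [exact: idl0 (gen_idealP s)|ring].
by exists 0, a; split=> //; ring.
Qed.

Lemma gen_ideal_sub (s : seq A) K : is_ideal K -> (forall a, a \in s -> K a) -> subset (gen_ideal s) K.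
Proof.
move=> hK; elim: s => [|a s IH] h w; first by move/gen_ideal_nil ->; exact: idl0.
move/gen_ideal_cons => [r [v [hv ->]]]; apply: idlD => //.
  by apply: idlM => //; apply: h; rewrite mem_head.
by apply: IH hv => b hb; apply: h; rewrite inE hb orbT.
Qed.

Hypothesis hA : noetherian A.

Lemma noetherian_maximal (T : (A -> Prop) -> Prop) K0 : is_ideal K0 -> T K0 ->
  exists K, [/\ is_ideal K, T K & forall L, is_ideal L -> T L -> subset K L -> subset L K].
Proof.
move=> i0 t0; apply: NNPP => hn.
pose S := {K : A -> Prop | is_ideal K /\ T K}.
have next (K : S) : {L : S | strict_subset (sval K) (sval L)}.
  apply: constructive_indefinite_description; case: K => K [hK tK] /=.
  apply: NNPP => hn2; apply: hn; exists K; split=> // L hL tL hKL.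
  apply: NNPP => /not_subset_ex [u [h1 h2]]; apply: hn2.
  by exists (exist _ L (conj hL tL)); split=> //; exists u.
pose C n := iter n (fun K : S => sval (next K)) (exist _ K0 (conj i0 t0) : S).
have hC n : strict_subset (sval (C n)) (sval (C n.+1)) by exact: (svalP (next (C n))).
have [N hN] := hA (fun n => (svalP (C n)).1) (fun n => (hC n).1).
by have [_ [u [h1 h2]]] := hC N; apply: h2; apply/(hN N.+1).
Qed.

Lemma noetherian_fg K : is_ideal K -> exists s : seq A, sameset K (gen_ideal s).
Proof.
move=> hK; pose T L := exists s : seq A, (forall a, a \in s -> K a) /\ L = gen_ideal s.
have [L [hL [s [hs eL]] hm]] : exists L, [/\ is_ideal L, T L &
    forall L', is_ideal L' -> T L' -> subset L L' -> subset L' L].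
  by apply: (@noetherian_maximal T (gen_ideal [::])); [exact: gen_idealP|exists [::]].
exists s => w; split; last exact: gen_ideal_sub.
move=> hw; rewrite -eL; apply: (hm (gen_ideal (w :: s))); first exact: gen_idealP.
- exists (w :: s); split=> // a; rewrite inE => /orP[/eqP -> //|]; exact: hs.
- rewrite eL => v hv; apply/gen_ideal_cons; exists 0, v; split=> //; ring.
by apply: gen_ideal_mem; rewrite mem_head.
Qed.

(** The coefficient in position [d] may be zero, which makes this set an ideal. *)
Definition lead_ideal (C : {poly A} -> Prop) d : A -> Prop :=
  fun a => exists p, [/\ C p, (size p <= d.+1)%N & p`_d = a].

Lemma lead_ideal_ideal C d : is_ideal C -> is_ideal (lead_ideal C d).
Proof.
move=> hC; split; first by exists 0; rewrite size_poly0 coef0; split=> //; exact: idl0.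
split=> [_ _ [p [hp sp <-]] [q [hq sq <-]]|a _ [p [hp sp <-]]].
  exists (p + q); rewrite coefD; split=> //; first exact: idlD.
  by apply: leq_trans (size_polyD _ _) _; rewrite geq_max sp.
exists (a%:P * p); rewrite coefCM; split=> //; first exact: idlM.
by rewrite mul_polyC; apply: leq_trans (size_scale_leq _ _) sp.
Qed.

Lemma lead_ideal_le C C' d d' : is_ideal C' -> subset C C' -> (d <= d')%N ->
  subset (lead_ideal C d) (lead_ideal C' d').
Proof.
move=> hC' hs hd _ [p [hp sp <-]]; exists ('X^(d' - d) * p); split.
- by apply: idlM => //; apply: hs.
- apply/leq_sizeP => j hj; rewrite coefXnM; case: ltnP => // h.
  by apply: (leq_sizeP _ _ sp); lia.
by rewrite coefXnM; case: ltnP => h; [lia|congr (_ `_ _); lia].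
Qed.

Lemma finite_bound (P : nat -> nat -> Prop) r : (forall i m n, (m <= n)%N -> P i m -> P i n) ->
  (forall i, (i < r)%N -> exists n, P i n) -> exists n, forall i, (i < r)%N -> P i n.
Proof.
move=> hm; elim: r => [|r IH] h; first by exists 0%N.
have [n hn] := IH (fun i hi => h i (ltnW hi)); have [k hk] := h r (leqnn _).
exists (maxn n k) => i; rewrite ltnS leq_eqVlt => /orP[/eqP ->|hi].
  exact: hm (leq_maxr _ _) hk.
exact: hm (leq_maxl _ _) (hn i hi).
Qed.

Lemma hilbert_basis : noetherian {poly A}.
Proof.
move=> C hC hS; have iL n d := lead_ideal_ideal d (hC n).
have mono m n d d' : (m <= n)%N -> (d <= d')%N ->
    subset (lead_ideal (C m) d) (lead_ideal (C n) d').
  by move=> h h'; apply: lead_ideal_le => //; exact: (chain_le hS h).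
(* The diagonal chain handles all degrees from [N] on at once; only the finitely many degrees below
   [N] have to be stabilised separately. *)
have [N hN] := hA (fun n => iL n n) (fun n => mono n n.+1 n n.+1 (leqnSn n) (leqnSn n)).
have [M hM] : exists M, forall d, (d < N)%N -> forall n, subset (lead_ideal (C n) d) (lead_ideal (C M) d).
  apply: (@finite_bound (fun d M => forall n, subset (lead_ideal (C n) d) (lead_ideal (C M) d))).
    by move=> i m n hmn h k u /h; apply: mono.
  move=> d _; have [k hk] := hA (fun n => iL n d) (fun n => mono n n.+1 d d (leqnSn n) (leqnn d)).
  exists k => n u hu; apply/(hk (maxn n k) (leq_maxr _ _)).
  by apply: mono hu => //; apply: leq_maxl.
pose M0 := maxn M N; exists M0 => n hn p; split; last exact: (chain_le hS hn).
have lead d : subset (lead_ideal (C n) d) (lead_ideal (C M0) d).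
  have [hd|hd] := ltnP d N.
    by move=> u /(hM d hd); apply: mono => //; apply: leq_maxl.
  move=> u hu; have : lead_ideal (C (maxn n d)) (maxn n d) u.
    by apply: mono hu; [apply: leq_maxl|apply: leq_maxr].
  move/hN => /(_ (leq_trans hd (leq_maxr _ _))); apply: mono => //; exact: leq_maxr.
(* Induction on a bound for the size: subtracting an element of [C M0] with the same top coefficient
   lowers it. *)
move: (leqnn (size p)); move: {2}(size p) => k.
elim: k p => [|d IH] p.
  by rewrite leqn0 size_poly_eq0 => /eqP -> _; apply: idl0.
move=> sp hp; have [q [hq sq eq]] : lead_ideal (C M0) d p`_d by apply: lead; exists p.
rewrite -(subrK q p); apply: idlD => //; apply: IH; last first.
  by apply: idlB => //; apply: (chain_le hS hn).
apply/leq_sizeP => j; rewrite leq_eqVlt => /orP[/eqP <-|hj]; rewrite coefB ?eq ?subrr //.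
by rewrite (leq_sizeP _ _ sp) // (leq_sizeP _ _ sq) // subrr.
Qed.
End Noetherian.

(** * Generic combinations that are nonzerodivisors *)

Section GenericCombination.
Variable A : comNzRingType.
Implicit Types (K L P : A -> Prop).
Variables (X : nat -> A) (r : nat).

Definition unit_differences (lam : nat -> A) :=
  forall i j, i <> j -> exists u, u * (lam i - lam j) = 1.

Definition vars : A -> Prop := fun w => exists2 i, (i < r)%N & w = X i.
Definition saturated K := forall w, (forall i, (i < r)%N -> K (X i * w)) -> K w.
Definition saturation K : A -> Prop := fun w => exists s, forall u, ideal_pow vars s u -> K (u * w).

Lemma saturation_ideal K : is_ideal K -> is_ideal (saturation K).
Proof.
move=> hK; split; first by exists 0%N => u _; rewrite mulr0; apply: idl0.
split=> [v w [s hs] [t ht]|a w [s hs]]; last first.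
  by exists s => u /hs h; rewrite mulrCA; apply: idlM.
exists (maxn s t) => u hu; rewrite mulrDr; apply: idlD => //.
  by apply: hs; apply: pow_le hu; apply: leq_maxl.
by apply: ht; apply: pow_le hu; apply: leq_maxr.
Qed.

Lemma sub_saturation K : is_ideal K -> subset K (saturation K).
Proof. by move=> hK w hw; exists 0%N => u _; apply: idlM. Qed.

Lemma saturation_saturated K : is_ideal K -> saturated (saturation K).
Proof.
move=> hK w h.
have [s hs] : exists s, forall i, (i < r)%N -> forall u, ideal_pow vars s u -> K (u * (X i * w)).
  by apply: finite_bound => // i m n hmn hm u /(pow_le hmn); apply: hm.
exists s.+1 => u /=; move: u; apply: prod_ind.
- by rewrite mul0r; apply: idl0.
- by move=> u v hu hv; rewrite mulrDl; apply: idlD.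
move=> _ v [i hi ->] hv; have -> : X i * v * w = v * (X i * w) by ring.
exact: hs.
Qed.

Lemma saturated_pow K s w : is_ideal K -> saturated K ->
  (forall u, ideal_pow vars s u -> K (u * w)) -> K w.
Proof.
move=> hK hs; elim: s w => [|s IH] w h; first by rewrite -[w]mul1r; apply: h.
apply: hs => i hi; apply: IH => u hu; rewrite mulrA [u * _]mulrC; apply: h.
by apply: powS => //; exists i.
Qed.

(** A Vandermonde argument in the form of Newton division: splitting off ['X - c] leaves a quotient
    whose values at the other points are divided differences, and these stay in [P] because the
    differences of points are units. *)
Lemma poly_coefs_mem P (s : seq A) (p : {poly A}) : is_ideal P ->
  (forall i j, (i < size s)%N -> (j < size s)%N -> i <> j -> exists u, u * (s`_i - s`_j) = 1) ->
  (size p <= size s)%N -> (forall c, c \in s -> P p.[c]) -> forall i, P p`_i.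
Proof.
move=> hP; elim: s p => [|c s IH] p hs sp hp i.
  by move: sp; rewrite leqn0 size_poly_eq0 => /eqP ->; rewrite coef0; apply: idl0.
have /factor_theorem [q eq] : root (p - p.[c]%:P) c.
  by apply/rootP; rewrite hornerD hornerN hornerC subrr.
have sq : (size q <= size s)%N.
  have [->|q0] := eqVneq q 0; first by rewrite size_poly0.
  have h : (size (p - p.[c]%:P)%R <= (size s).+1)%N.
    apply: leq_trans (size_polyD _ _) _; rewrite geq_max sp size_polyN.
    by apply: leq_trans (size_polyC_leq1 _) _.
  by move: h; rewrite eq size_Mmonic ?monicXsubC // size_XsubC addn2.
have hq j : P q`_j.
  apply: IH => // [i1 i2 h1 h2 h12|c' hc'].
    by apply: (hs i1.+1 i2.+1) => // -[].
  have [u hu] : exists u, u * (c' - c) = 1.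
    have h := hs (index c' s).+1 0%N; rewrite /= nth_index // in h.
    by apply: h; rewrite ?ltnS ?index_mem.
  have -> : q.[c'] = u * (p.[c'] - p.[c]).
    have := congr1 (fun f => f.[c']) eq; rewrite /= !hornerE => ->.
    by rewrite mulrCA hu mulr1.
  by apply: idlM => //; apply: idlB => //; apply: hp; rewrite inE ?hc' ?orbT ?eqxx.
have -> : p = q * ('X - c%:P) + p.[c]%:P by rewrite -eq subrK.
rewrite coefD mulrBr coefB coefMX coefMC coefC; apply: idlD => //.
  apply: idlB => //; last exact: idlMr.
  by case: ifP => // _; apply: idl0.
by case: ifP => _; [apply: hp; rewrite mem_head|apply: idl0].
Qed.

Definition combination (a : A) := \sum_(i < r) a ^+ i * X i.

(** Prime avoidance by noetherian induction. A maximal saturated counterexample [P] is prime, so it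
    contains [combination (lam n)] for infinitely many [n]; by Vandermonde it contains every [X i],
    hence 1 by saturation, and is no counterexample. *)
Lemma combination_nzd (lam : nat -> A) K0 : noetherian A -> unit_differences lam ->
  is_ideal K0 -> saturated K0 -> exists N, forall n, (N <= n)%N -> nzd K0 (combination (lam n)).
Proof.
move=> hA hlam i0 s0; apply: NNPP => bad0.
pose good K := exists N, forall n, (N <= n)%N -> nzd K (combination (lam n)).
have [P [iP [sP badP] maxP]] :=
  @noetherian_maximal _ hA (fun K => saturated K /\ ~ good K) K0 i0 (conj s0 bad0).
have goodP L : is_ideal L -> saturated L -> subset P L -> ~ subset L P -> good L.
  by move=> iL sL h h'; apply: NNPP => hn; apply: h'; apply: maxP.
(* The maximal bad ideal is prime: otherwise it lies properly below both
   [P : a] and the saturation of [P + (a)], and goodness of these two gives goodness of [P]. *)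
have primeP a b : P (a * b) -> P a \/ P b.
  move=> hab; apply: NNPP => /not_or_and [na nb]; apply: badP.
  have [N1 h1] : good (quotI P a).
    apply: goodP; first by ideal.
    - by move=> w h; apply: sP => i hi; rewrite mulrCA; apply: h.
    - by move=> w hw; apply: idlM.
    by move=> h; apply: nb; apply: h.
  have iPa : is_ideal (addI P (prI a)) by ideal.
  have [N2 h2] : good (saturation (addI P (prI a))).
    apply: goodP; first exact: saturation_ideal.
    - exact: saturation_saturated.
    - by move=> w hw; apply: sub_saturation => //; apply: sub_addl => //; ideal.
    move=> h; apply: na; apply: h; apply: sub_saturation => //.
    by apply: sub_addr => //; exact: prI_self.
  exists (maxn N1 N2) => n; rewrite geq_max => /andP[/h1 {}h1 /h2 {}h2] w hw.
  have [s hs] : saturation (addI P (prI a)) w.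
    by apply: h2; apply: sub_saturation => //; apply: sub_addl => //; ideal.
  apply: (@saturated_pow P s) => // u /hs [q [_ [hq [[t ->] e]]]].
  rewrite e; apply: idlD => //; rewrite mulrC; apply: h1; rewrite /quotI.
  have -> : a * (combination (lam n) * t) = u * (combination (lam n) * w) - combination (lam n) * q.
    by rewrite [u * _]mulrCA e; ring.
  by apply: idlB => //; apply: idlM.
have [l [ls lu lP]] : exists l : seq nat,
    [/\ size l = r, uniq l & forall n, n \in l -> P (combination (lam n))].
  elim: {1}r => [|k [l [ls lu lP]]]; first by exists [::].
  (* The sum of the list dominates its members, so an index beyond it is new. *)
  have [n [hn hPn]] : exists n, ((sumn l).+1 <= n)%N /\ P (combination (lam n)).
    apply: NNPP => hn; apply: badP; exists (sumn l).+1 => n hn' w hw.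
    by have [h|//] := primeP _ _ hw; case: hn; exists n.
  exists (n :: l); split; rewrite /= ?ls ?lu ?andbT //; last first.
    by move=> n'; rewrite inE => /orP[/eqP -> //|]; exact: lP.
  apply/negP => hnl; have : (n <= sumn l)%N; last by lia.
  by elim: (l) hnl => //= b l' IH; rewrite inE => /orP[/eqP ->|/IH]; lia.
have PX i : (i < r)%N -> P (X i).
  move=> hi; have := @poly_coefs_mem P [seq lam n | n <- l] (\poly_(i < r) X i) iP _ _ _ i.
  rewrite coef_poly hi; apply.
  - rewrite size_map => i1 i2 h1 h2 h12; rewrite !(nth_map 0%N) //; apply: hlam => /eqP.
    by rewrite nth_uniq // => /eqP.
  - by rewrite size_map ls; apply: size_poly.
  move=> _ /mapP [n hn ->]; rewrite horner_poly.
  have := lP n hn; rewrite /combination; congr (P _); apply: eq_bigr => j _; exact: mulrC.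
apply: badP; exists 0%N => n _ w _; rewrite -[w]mulr1; apply: idlM => //.
by apply: sP => i hi; rewrite mulr1; apply: PX.
Qed.
End GenericCombination.

(** * The Rees algebra, Artin-Rees and superficial elements *)

Section ReesAlgebra.
Variable R : comNzRingType.
Implicit Types (I Q : R -> Prop).

Definition rees I : {poly R} -> Prop := fun p => forall n, ideal_pow I n p`_n.

Lemma reesD I p q : rees I p -> rees I q -> rees I (p + q).
Proof. by move=> hp hq n; rewrite coefD; apply: idlD => //; apply: pow_ideal. Qed.

Lemma reesM I p q : rees I p -> rees I q -> rees I (p * q).
Proof.
move=> hp hq n; rewrite coefM; apply: idl_sum => [|j _]; first exact: pow_ideal.
by rewrite -{1}(subnKC (ltn_ord j : (j <= n)%N)); apply: powM.
Qed.

Lemma reesC I a : rees I a%:P.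
Proof. by case=> [|n]; rewrite coefC //=; apply: idl0; exact: (pow_ideal I n.+1). Qed.

Lemma rees_linear I g : I g -> rees I (g *: 'X).
Proof.
move=> hg n; rewrite coefZ coefX; case: eqP => [->|_].
  by rewrite mulr1; apply: pow1.
by rewrite mulr0; apply: idl0; apply: pow_ideal.
Qed.

(** [A] is a polynomial ring over [R] with one variable per generator. Graded ideals of the Rees
    algebra are pulled back to [A], where chains stabilise by the basis theorem. *)
Lemma rees_presentation I (g : seq R) : noetherian R -> (forall u, u \in g -> I u) ->
  exists (A : comNzRingType) (f : {rmorphism A -> {poly R}}) (C : {rmorphism R -> A}) (X : nat -> A),
    [/\ noetherian A, forall a, f (C a) = a%:P,
        forall i, (i < size g)%N -> f (X i) = g`_i *: 'X & forall p, rees I (f p)].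
Proof.
move=> hR; elim: g => [|a g IH] hg.
  exists R, (polyC : {rmorphism R -> {poly R}}), (idfun : {rmorphism R -> R}), (fun _ => 0).
  by split=> // p; apply: reesC.
have [A [f [C [X [hA hC hX hf]]]]] := IH (fun u hu => hg u (mem_behead (s := a :: g) hu)).
have cf : commr_rmorph f (a *: 'X) by move=> p; apply: mulrC.
exists {poly A}, (horner_morph cf : {rmorphism {poly A} -> {poly R}}),
  (polyC \o C : {rmorphism R -> {poly A}}), (fun i => if i is i'.+1 then (X i')%:P else 'X).
split.
- exact: hilbert_basis.
- by move=> b /=; rewrite horner_morphC hC.
- by case=> [|i] hi /=; [rewrite horner_morphX|rewrite horner_morphC hX].
move=> p /=; rewrite /horner_morph horner_coef; apply: big_ind => //=.
- by rewrite -[0]/(0%:P); apply: reesC.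
- by move=> u v; apply: reesD.
move=> i _; apply: reesM; first by rewrite coef_map; apply: hf.
elim: (nat_of_ord i) => [|k IHk]; first by rewrite expr0; apply: reesC.
by rewrite exprS; apply: reesM => //; apply: rees_linear; apply: hg; rewrite mem_head.
Qed.

Section Presentation.
Variables (g : seq R) (A : comNzRingType) (f : {rmorphism A -> {poly R}})
  (C : {rmorphism R -> A}) (X : nat -> A).
Hypotheses (hA : noetherian A) (hC : forall a, f (C a) = a%:P)
  (hX : forall i, (i < size g)%N -> f (X i) = g`_i *: 'X)
  (hf : forall p, rees (gen_ideal g) (f p)).
Let I := gen_ideal g.

Lemma presentation_onto n w : ideal_pow I n w ->
  exists2 p, ideal_pow (vars X (size g)) n p & f p = w *: 'X^n.
Proof.
elim: n w => [|n IH] w; first by exists (C w) => //; rewrite hC expr0 alg_polyC.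
have iV := pow_ideal (vars X (size g)) n.+1.
move: w; apply: (@prod_ind _ I (ideal_pow I n)).
- by exists 0; [exact: idl0|rewrite rmorph0 scale0r].
- move=> u v [p hp ep] [q hq eq]; exists (p + q); first exact: idlD.
  by rewrite rmorphD ep eq scalerDl.
move=> _ v [c [_ ->]] /IH [p hp ep].
exists (\sum_(i < size g) C c`_i * (X i * p)).
  by apply: idl_sum => // i _; apply: idlM => //; apply: powS => //; exists i.
rewrite rmorph_sum mulr_suml scaler_suml; apply: eq_bigr => i _.
by rewrite !rmorphM hC hX // ep mul_polyC -scalerAl -scalerAr -exprS !scalerA.
Qed.

(** For each [s] the family [E s] is a graded ideal of the Rees algebra; its preimage in [A] is
    [D s], and stability of these preimages gives one bound for all degrees. *)
Lemma rees_acc (E : nat -> nat -> R -> Prop) : (forall s n, is_ideal (E s n)) ->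
  (forall s n, subset (E s n) (ideal_pow I n)) ->
  (forall s n u v, I u -> E s n v -> E s n.+1 (u * v)) ->
  (forall s n, subset (E s n) (E s.+1 n)) ->
  exists S, forall s n, (S <= s)%N -> subset (E s n) (E S n).
Proof.
move=> iE sE mE hE.
have mE' s j n u v : ideal_pow I j u -> E s n v -> E s (j + n)%N (u * v).
  move=> + hv; elim: j u => [|j IH] u; first by move=> _; rewrite add0n; apply: idlM.
  move: u; apply: (@prod_ind _ I (ideal_pow I j)).
  - by rewrite mul0r; apply: idl0.
  - by move=> a b ha hb; rewrite mulrDl; apply: idlD.
  by move=> a b ha /IH hb; rewrite -mulrA; apply: mE.
pose D s (p : A) := forall n, E s n (f p)`_n.
have iD s : is_ideal (D s).
  split; first by move=> n; rewrite rmorph0 coef0; apply: idl0.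
  split=> [p q hp hq n|a p hp n]; first by rewrite rmorphD coefD; apply: idlD.
  rewrite rmorphM coefM; apply: idl_sum => // j _.
  rewrite -[n in E s n](subnKC (ltn_ord j : (j <= n)%N)); apply: mE' => //; exact: hf.
have [S hS] := hA iD (fun s p hp n => hE s n _ (hp n)).
exists S => s n hs w hw; have [p _ ep] := presentation_onto (sE _ _ _ hw).
have hp : D s p.
  move=> k; rewrite ep coefZ coefXn; case: eqP => [->|_]; first by rewrite mulr1.
  by rewrite mulr0; apply: idl0.
by have := (hS s hs p).1 hp n; rewrite ep coefZ coefXn eqxx mulr1.
Qed.

Lemma artin_rees K : is_ideal K -> exists s, forall n w, (s <= n)%N ->
  ideal_pow I n w -> K w -> prod_ideal (ideal_pow I (n - s)) (fun u => ideal_pow I s u /\ K u) w.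
Proof.
move=> hK; pose D s u := ideal_pow I s u /\ K u.
have iD s : is_ideal (D s).
  have hP := pow_ideal I s; split; first by split; apply: idl0.
  split=> [u v [h1 h2] [h3 h4]|a u [h1 h2]]; first by split; apply: idlD.
  by split; apply: idlM.
(* [E s] is the part, generated in degrees at most [s], of the graded ideal with terms [D n]. The
   Artin-Rees exponent is where this family stabilises. *)
pose E s n := if (n <= s)%N then D n else prod_ideal (ideal_pow I (n - s)) (D s).
have iE s n : is_ideal (E s n) by rewrite /E; case: ifP => _ //; apply: prod_is_ideal.
have subD k s : subset (prod_ideal (ideal_pow I k) (D s)) (D (k + s)%N).
  by apply: prod_sub => // u v hu [hv1 hv2]; split; [exact: powM|exact: idlM].
have sE s n : subset (E s n) (D n).
  by rewrite /E; case: leqP => h w hw //; have := subD _ _ _ hw; rewrite subnK // ltnW.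
have [||S hS] := rees_acc iE (fun s n w hw => (sE s n w hw).1).
- move=> s n u v hu; rewrite /E; case: (leqP n s) => hns.
    move=> hv; case: (leqP n.+1 s) => h.
      by split; [apply: powS => //; exact: hv.1|apply: idlM => //; exact: hv.2].
    have e : n = s by lia.
    by rewrite e subSnn; apply: prod_mul; [exact: pow1|rewrite -e].
  rewrite ltnNge (ltnW hns) /= subSn; last exact: ltnW.
  move: v; apply: (@prod_ind _ _ _ (fun v => prod_ideal _ _ (u * v))).
  + by rewrite mulr0; apply: idl0; apply: prod_is_ideal.
  + by move=> a b ha hb; rewrite mulrDr; apply: idlD => //; apply: prod_is_ideal.
  by move=> a b ha hb; rewrite mulrA; apply: prod_mul => //; apply: powS.
- move=> s n w; rewrite {2}/E; case: leqP => hns.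
    by move=> hw; apply: sE hw.
  rewrite /E leqNgt (ltnW hns) /=; move: w; apply: prod_sub; first exact: prod_is_ideal.
  have -> : (n - s = (n - s.+1) + 1)%N by lia.
  move=> u v /pow_add hu hv; have iP := @prod_is_ideal R (ideal_pow I (n - s.+1)) _ (iD s.+1).
  move: u hu; apply: (@prod_ind _ _ _ (fun u => prod_ideal _ _ (u * v))).
  + by rewrite mul0r; apply: idl0.
  + by move=> a b ha hb; rewrite mulrDl; apply: idlD.
  move=> a b ha hb; rewrite -mulrA; apply: prod_mul => //.
  by split; [exact: (powM hb hv.1)|apply: idlM => //; exact: hv.2].
exists S => n w hn h1 h2; have := hS n n hn w; rewrite /E leqnn => /(_ (conj h1 h2)).
case: leqP => // h; have -> : n = S by lia.
by move=> hw; rewrite subnn -[w]mul1r; apply: prod_mul.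
Qed.

(** The initial form of the generic combination is injective on the graded ring of [I] on [R/Q] in
    high degrees: it is a nonzerodivisor modulo the saturation of the kernel [q], and that
    saturation agrees with [q] in high degrees. *)
Lemma superficial_degrees Q (lam : nat -> R) : is_ideal Q -> unit_differences lam ->
  exists N, forall n, (N <= n)%N -> exists n1, forall m w, (n1 <= m)%N -> ideal_pow I m w ->
    addI (ideal_pow I m.+2) Q (combination (nth 0 g) (size g) (lam n) * w) ->
    addI (ideal_pow I m.+1) Q w.
Proof.
move=> hQ hlam; pose q (p : A) := forall n, addI (ideal_pow I n.+1) Q (f p)`_n.
have iIQ n : is_ideal (addI (ideal_pow I n) Q) by apply: add_ideal => //; apply: pow_ideal.
have mulIQ i n u v : ideal_pow I i u -> addI (ideal_pow I n) Q v -> addI (ideal_pow I (i + n)) Q (u * v).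
  move=> hu [a [b [ha [hb ->]]]]; exists (u * a), (u * b).
  by split; [exact: powM|split; [exact: idlM|ring]].
have iq : is_ideal q.
  split; first by move=> n; rewrite rmorph0 coef0; apply: idl0.
  split=> [p p' hp hp' n|a p hp n]; first by rewrite rmorphD coefD; apply: idlD.
  rewrite rmorphM coefM; apply: idl_sum => // j _.
  have e : (j + (n - j).+1 = n.+1)%N by have := ltn_ord j; lia.
  by have := mulIQ _ _ _ _ (hf a j) (hp (n - j)%N); rewrite e.
set V := vars X (size g); pose t := saturation X (size g) q.
have it : is_ideal t by exact: saturation_ideal.
have hlamC : unit_differences (fun n => C (lam n)).
  move=> i j /hlam [u hu]; exists (C u); by rewrite -rmorphB -rmorphM hu rmorph1.
have [N hN] := combination_nzd hA hlamC it (saturation_saturated iq).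
have [ps hps] := noetherian_fg hA it.
have [s hs] : exists s, forall i, (i < size ps)%N -> forall u, ideal_pow V s u -> q (u * ps`_i).
  apply: (@finite_bound (fun i s => forall u, ideal_pow V s u -> q (u * ps`_i))).
    by move=> i m n hmn h u /(pow_le hmn); apply: h.
  by move=> i hi; have : t ps`_i by apply/hps; apply: gen_ideal_mem; apply: mem_nth.
have [e he] : exists e, forall i, (i < size ps)%N -> (size (f ps`_i)%R <= e)%N.
  apply: (@finite_bound (fun i e => (size (f ps`_i)%R <= e)%N)).
    by move=> i m n hmn h; apply: leq_trans hmn.
  by move=> i _; exists (size (f ps`_i)%R).
exists N => n hn; exists (e + s)%N => m w hm hw hxw.
have [p _ ep] := presentation_onto hw.
have fx : f (combination X (size g) (C (lam n))) = combination (nth 0 g) (size g) (lam n) *: 'X.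
  rewrite /combination rmorph_sum scaler_suml; apply: eq_bigr => i _.
  by rewrite rmorphM rmorphXn hC hX // -polyC_exp mul_polyC scalerA.
have /hps [c [_ epc]] : t p.
  apply: (hN n hn); apply: sub_saturation => // k.
  rewrite rmorphM fx ep -scalerAl -scalerAr -exprS scalerA coefZ coefXn.
  by case: eqP => [->|_]; rewrite ?mulr1 ?mulr0 //; apply: idl0.
have -> : w = (f p)`_m by rewrite ep coefZ coefXn eqxx mulr1.
rewrite epc rmorph_sum coef_sum; apply: idl_sum => // j _.
rewrite rmorphM coefM; apply: idl_sum => // i _.
have him : (i <= m)%N by rewrite -ltnS.
(* Since [m >= e + s], either the generator has no coefficient in degree [m - i], or the cofactor
   has degree at least [s] and carries the generator into [q]. *)
have [h|h] := leqP e (m - i).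
  by rewrite [(f ps`_j)`_(m - i)](leq_sizeP _ _ (he j (ltn_ord j))) // mulr0; apply: idl0.
have : ideal_pow I (i - s + s) (f c`_j)`_i by rewrite subnK; [exact: hf|lia].
move=> /pow_add; move: (f c`_j)`_i.
apply: (@prod_ind _ _ _ (fun u => addI (ideal_pow I m.+1) Q (u * (f ps`_j)`_(m - i)))).
- by rewrite mul0r; apply: idl0.
- by move=> a b ha hb; rewrite mulrDl; apply: idlD.
move=> a b ha hb; rewrite -mulrA.
have em : (i - s + (s + (m - i)).+1 = m.+1)%N by lia.
suff hbf : addI (ideal_pow I (s + (m - i)).+1) Q (b * (f ps`_j)`_(m - i)).
  by have := mulIQ _ _ _ _ ha hbf; rewrite em.
have [u hu eu] := presentation_onto hb.
have := hs j (ltn_ord j) u hu (s + (m - i))%N.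
by rewrite rmorphM eu -scalerAl coefZ coefXnM ltnNge leq_addr /= addKn.
Qed.
End Presentation.

Lemma superficial_exists (g : seq R) Q (lam : nat -> R) : noetherian R -> is_ideal Q ->
  unit_differences lam -> (exists2 s, gen_ideal g s & nzd Q s) ->
  exists N, forall n, (N <= n)%N ->
    let x := combination (nth 0 g) (size g) (lam n) in
    nzd Q x /\ exists n0, forall m w, (n0 <= m)%N ->
      addI (ideal_pow (gen_ideal g) m.+1) Q (x * w) -> addI (ideal_pow (gen_ideal g) m) Q w.
Proof.
move=> hR hQ hlam [s0 Is0 ns0]; set I := gen_ideal g.
have [A [f [C [X [hA hC hX hf]]]]] := rees_presentation hR (@gen_ideal_mem R g).
(* A nonzerodivisor modulo [Q] inside the ideal makes [Q] saturated with respect to the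
   generators. *)
have [|N1 h1] := @combination_nzd R (nth 0 g) (size g) lam Q hR hlam hQ.
  move=> w h; apply: ns0; move: Is0 => [c [_ ->]]; rewrite mulr_suml.
  by apply: idl_sum => // i _; rewrite -mulrA; apply: idlM => //; apply: h.
have [N2 h2] := superficial_degrees hA hC hX hf hQ hlam.
exists (maxn N1 N2) => n; rewrite geq_max => /andP[/h1 {}h1 /h2 [n1 {}h2]] x; split=> //.
have hQx : is_ideal (addI Q (prI x)) by ideal.
have [s hs] := artin_rees hA hC hX hf hQx.
exists (n1 + s)%N => m w hm hxw.
have iIQ k : is_ideal (addI (ideal_pow I k) Q) by apply: add_ideal => //; apply: pow_ideal.
suff : forall d, (d <= s)%N -> addI (ideal_pow I (m - (s - d))) Q w.
  by move=> /(_ s (leqnn s)); rewrite subnn subn0.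
(* Artin-Rees for [Q + (x)] writes [v] as [q' + x w'] with a loss of at most [s] degrees; cancelling
   [x] modulo [Q] compares [w] with [w']. The lost degrees are then regained one at a time by
   [h2]. *)
have start : addI (ideal_pow I (m.+1 - s)) Q w.
  have [v [q [hv [hq exw]]]] := hxw.
  have hv' : addI Q (prI x) v.
    exists (- q), (x * w); split; first exact: idlN.
    by split; [exact: prI_mul|rewrite exw; ring].
  have hsm : (s <= m.+1)%N by lia.
  have [q' [w' [hq' hw' ev]]] : exists q' w', [/\ Q q', ideal_pow I (m.+1 - s) w' & v = q' + x * w'].
    have := hs _ _ hsm hv hv'; move: (v); apply: prod_ind.
    - by exists 0, 0; split; [exact: idl0|apply: idl0; apply: pow_ideal|ring].
    - move=> _ _ [a [b [ha hb ->]]] [a' [b' [ha' hb' ->]]].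
      exists (a + a'), (b + b'); split; [exact: idlD| |ring].
      by apply: idlD => //; apply: pow_ideal.
    move=> u _ hu [_ [a [_ [ha [[r ->] ->]]]]]; exists (u * a), (r * u).
    by split; [exact: idlM|apply: idlM => //; exact: pow_ideal|ring].
  exists w', (w - w'); split=> //; split; last by ring.
  apply: h1; rewrite -/x; have -> : x * (w - w') = q + q' by rewrite mulrBr exw ev; ring.
  exact: idlD.
elim=> [|d IH] hd; first by apply: addIS start => //; apply: pow_le; lia.
have [u [q [hu [hq eu]]]] := IH (ltnW hd).
have : addI (ideal_pow I (m - (s - d)).+1) Q u.
  apply: h2 => //; first lia.
  have : addI (ideal_pow I m.+1) Q (x * u).
    have -> : x * u = x * w - x * q by rewrite eu; ring.
    by apply: idlB => //; apply: sub_addr; [exact: pow_ideal|exact: idlM].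
  by apply: addIS => //; apply: pow_le; lia.
have -> : (m - (s - d)).+1 = (m - (s - d.+1))%N by lia.
by move=> h; rewrite eu; apply: idlD => //; apply: sub_addr => //; exact: pow_ideal.
Qed.
End ReesAlgebra.

(** * Nakayama's lemma and integrality from bounded loss of order *)

Section LocalRing.
Variable R : comNzRingType.
Implicit Types (m I K L Q : R -> Prop).

Lemma set_ext K L : sameset K L -> K = L.
Proof.
by move=> h; apply: functional_extensionality => u; apply: propositional_extensionality; apply: h.
Qed.

Lemma local_ring_unit m u : local_ring m -> ~ m u -> exists v, v * u = 1.
Proof.
move=> [_ hm] hu; apply: NNPP => hn; apply: hu; apply: (hm (prI u)); last exact: prI_self.
by split; [ideal|move=> [v hv]; apply: hn; exists v].
Qed.

Lemma local_ring_ideal m : local_ring m -> is_ideal m.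
Proof. by case=> [[[]]]. Qed.

Lemma local_ring_1B m a : local_ring m -> m a -> exists v, v * (1 - a) = 1.
Proof.
move=> hl ha; apply: (local_ring_unit hl) => h; have [[[hm h1] _] _] := hl; apply: h1.
by rewrite -[1](subrK a); apply: idlD.
Qed.

(** Induction on the generators: the relation for [a] has an invertible coefficient [1 - c], so [a]
    can be eliminated from the relations of the others. *)
Lemma nakayama m L (s : seq R) : local_ring m -> is_ideal L ->
  subset (gen_ideal s) (addI L (prod_ideal m (gen_ideal s))) -> subset (gen_ideal s) L.
Proof.
move=> hl hL; have im := local_ring_ideal hl.
elim: s => [|a s IH] h; first by move=> u /gen_ideal_nil ->; exact: idl0.
have iG := gen_idealP s; have iP := prod_is_ideal m iG.
have split_prod w : prod_ideal m (gen_ideal (a :: s)) w ->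
    exists c v, [/\ m c, prod_ideal m (gen_ideal s) v & w = c * a + v].
  move: w; apply: prod_ind.
  - by exists 0, 0; split; [exact: idl0|exact: idl0|ring].
  - move=> _ _ [c [v [hc hv ->]]] [c' [v' [hc' hv' ->]]].
    by exists (c + c'), (v + v'); split; [exact: idlD|exact: idlD|ring].
  move=> c _ hc /gen_ideal_cons [r [v [hv ->]]]; exists (c * r), (c * v).
  by split; [exact: idlMr|exact: prod_mul|ring].
have [l [_ [hla [/split_prod [c [v [hc hv ->]]] ea]]]] :
    addI L (prod_ideal m (gen_ideal (a :: s))) a.
  by apply: h; apply: gen_ideal_mem; rewrite mem_head.
have [u hu] := local_ring_1B hl hc.
have {}ea : a = u * l + u * v.
  have e : (1 - c) * a = l + v by rewrite mulrBl mul1r {1}ea; ring.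
  by rewrite -mulrDr -e mulrA hu mul1r.
have hs : subset (gen_ideal s) L.
  apply: IH => w hw; have : gen_ideal (a :: s) w.
    by apply/gen_ideal_cons; exists 0, w; split=> //; ring.
  move=> /h [l' [_ [hl' [/split_prod [c' [v' [hc' hv' ->]]] ->]]]].
  exists (l' + c' * u * l), (c' * u * v + v'); split; first by apply: idlD => //; apply: idlM.
  by split; [apply: idlD => //; apply: idlM|rewrite {1}ea; ring].
move=> w /gen_ideal_cons [r [t [/hs ht ->]]]; apply: idlD => //; apply: idlM => //.
rewrite ea; apply: idlD; [by []|exact: idlM|apply: idlM => //; apply: hs].
by move: v hv {ea}; apply: prod_sub => // *; apply: idlM.
Qed.

Lemma nakayama_pow m I L n : noetherian R -> local_ring m -> is_ideal L -> subset I m ->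
  subset (ideal_pow I n) (addI L (ideal_pow I n.+1)) -> subset (ideal_pow I n) L.
Proof.
move=> hR hl hL hI h; have [s hs] := noetherian_fg hR (pow_ideal I n).
move=> u /hs; apply: (nakayama hl hL) => w /hs /h.
apply: addIS => // v; apply: prod_sub; first by apply: prod_is_ideal; apply: gen_idealP.
by move=> a b /hI ha /hs hb; apply: prod_mul.
Qed.

Lemma rees_families_acc (g : seq R) (E : nat -> nat -> R -> Prop) : noetherian R ->
  (forall s n, is_ideal (E s n)) ->
  (forall s n, subset (E s n) (ideal_pow (gen_ideal g) n)) ->
  (forall s n u v, gen_ideal g u -> E s n v -> E s n.+1 (u * v)) ->
  (forall s n, subset (E s n) (E s.+1 n)) ->
  exists S, forall s n, (S <= s)%N -> subset (E s n) (E S n).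
Proof.
move=> hR; have [A [f [C [X [hA hC hX hf]]]]] := rees_presentation hR (@gen_ideal_mem R g).
exact: (rees_acc hA hC hX hf).
Qed.

Lemma pow_span_sum I a j T w : pow_span I a j T w -> exists v : nat -> R,
  (forall l, (l <= j)%N -> ideal_pow I (T - l) (v l)) /\ w = \sum_(l < j.+1) a ^+ l * v l.
Proof.
elim: j w => [|j IH] w.
  move=> hw; exists (fun _ => w); rewrite big_ord_recr big_ord0 /= add0r mul1r; split=> // l.
  by rewrite leqn0 => /eqP ->; rewrite subn0.
move=> [_ [_ [/IH [v [hv ->]] [[u hu ->] ->]]]].
exists (fun l => if l == j.+1 then u else v l); split.
  move=> l; case: eqP => [->|hl] // h; apply: hv; lia.
rewrite [in RHS]big_ord_recr /= eqxx; congr (_ + _); apply: eq_bigr => i _.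
by rewrite ltn_eqF.
Qed.

Lemma pow_span_integral I a j : pow_span I a j j.+1 (a ^+ j.+1) -> integral_over_ideal I a.
Proof.
move=> /pow_span_sum [v [hv e]]; exists j.+1, (fun i => - v (j.+1 - i)%N); split=> //; split.
  move=> i /andP[h1 h2]; apply: idlN; first exact: pow_ideal.
  have := hv (j.+1 - i)%N; rewrite subKn //; apply; lia.
rewrite big_add1 big_mkord (reindex_inj rev_ord_inj) /= e -big_split /=.
apply: big1 => i _; rewrite !subSS subKn //; last by rewrite -ltnS.
ring.
Qed.

(** After a shift by [C], the pieces [pow_span j] are graded ideals of the Rees algebra that
    increase with [j]. Once they are stable, some [a^(j+1)] lies in [pow_span j j.+1], which is an
    equation of integral dependence. *)
Lemma integral_of_bounded (g : seq R) a C : noetherian R ->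
  (forall l, ideal_pow (gen_ideal g) (l - C) (a ^+ l)) -> integral_over_ideal (gen_ideal g) a.
Proof.
move=> hR ha; set I := gen_ideal g.
have [||||S hS] := @rees_families_acc g (fun j n => pow_span I a j (n + C)) hR.
- by move=> j n; apply: pow_span_ideal.
- move=> j n; have := @pow_span_bound R I a C j (n + C) (fun l _ => ha l).
  by rewrite addnK.
- move=> j n u v hu hv; rewrite mulrC; move: v hv.
  suff h : subset (pow_span I a j (n + C)) (quotI (pow_span I a j (n.+1 + C)) u).
    by move=> v /h; rewrite /quotI mulrC.
  apply: pow_span_sub => [|l v hl hv]; first by apply: quot_ideal; apply: pow_span_ideal.
  rewrite /quotI mulrCA; apply: pow_span_mem => //.
  by apply: pow_le (powS hu hv); lia.
- by move=> j n; apply: pow_spanS.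
pose j := maxn S C; apply: (@pow_span_integral I a j).
have mono k : (S <= k)%N -> subset (pow_span I a S j.+1) (pow_span I a k j.+1).
  move=> /subnKC <-; elim: (k - S)%N => [|d IH] u; first by rewrite addn0.
  by move=> /IH /pow_spanS; rewrite addnS.
apply: mono; first exact: leq_maxl.
have ej : (j.+1 - C + C = j.+1)%N by rewrite subnK // leqW // leq_maxr.
rewrite -[X in pow_span I a S X]ej; apply: (hS j.+1); first by rewrite leqW // leq_maxl.
by rewrite ej -[a ^+ j.+1]mulr1; apply: pow_span_mem => //; rewrite subnn.
Qed.
End LocalRing.

(** * Superficial sequences as reductions, and integrality of [a] from [a y^k] *)

Section SuperficialSequence.
Variable R : comNzRingType.
Implicit Types (Q : R -> Prop).
Variable g : seq R.
Let I := gen_ideal g.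

Definition superficial Q n0 x := forall n w, (n0 <= n)%N ->
  addI (ideal_pow I n.+1) Q (x * w) -> addI (ideal_pow I n) Q w.

Lemma superficial_le Q m n x : (m <= n)%N -> superficial Q m x -> superficial Q n x.
Proof. by move=> hmn h k w hk; apply: h; apply: leq_trans hk. Qed.

Lemma superficial_split Q n0 x n w : is_ideal Q -> superficial Q n0 x -> I x -> (n0 <= n)%N ->
  ideal_pow I n.+1 w -> addI Q (prI x) w ->
  exists u h, [/\ ideal_pow I n u, Q h, ideal_pow I n.+1 h & w = x * u + h].
Proof.
move=> hQ hs Ix hn hw [q [_ [hq [[r ->] e]]]].
have [u [q' [hu [hq' er]]]] : addI (ideal_pow I n) Q r.
  apply: hs => //; exists w, (- q); split=> //; split; [exact: idlN|rewrite e; ring].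
exists u, (x * q' + q); split=> //.
- by apply: idlD => //; apply: idlM.
- have -> : x * q' + q = w - x * u by rewrite e er; ring.
  by apply: idlB => //; [exact: pow_ideal|exact: powS].
by rewrite e er; ring.
Qed.

Variables x y z : R.
Hypotheses (Ix : I x) (Iy : I y) (Iz : I z).
Let Q0 := @zeroI R.
Let Q1 := addI Q0 (prI x).
Let Q2 := addI Q1 (prI y).
Let Q3 := addI Q2 (prI z).
Variable n0 : nat.
Hypotheses (sx : superficial Q0 n0 x) (sy : superficial Q1 n0 y) (sz : superficial Q2 n0 z).
Hypothesis hQ3 : forall n, (n0 <= n)%N -> subset (ideal_pow I n) Q3.

Let iQ0 : is_ideal Q0. Proof. exact: zero_ideal. Qed.
Let iQ1 : is_ideal Q1. Proof. by rewrite /Q1; ideal. Qed.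
Let iQ2 : is_ideal Q2. Proof. by rewrite /Q2; ideal. Qed.

(** An element of [I^(n+1)] lying in [Q3] is split off along [z], then [y], then [x]; superficiality
    keeps each cofactor in [I^n], to which induction applies. *)
Lemma superficial_reduction m : subset (ideal_pow I (n0 + m)) (triple_powers x y z m).
Proof.
have hF := triple_powers_filtration x y z; have [iJ _ hM] := hF.
elim: m => [|m IH] w // hw; rewrite addnS in hw.
have hn : (n0 <= n0 + m)%N := leq_addr _ _.
have hw3 := hQ3 (leqW hn) hw.
have [u [h [hu hh hhI ->]]] := superficial_split iQ2 sz Iz hn hw hw3.
have [u' [h' [hu' hh' hhI' ->]]] := superficial_split iQ1 sy Iy hn hhI hh.
have [u'' [h'' [hu'' hh'' _ ->]]] := superficial_split iQ0 sx Ix hn hhI' hh'.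
rewrite hh'' addr0.
have J1 := triple_powers_x x y z; have J2 := triple_powers_y x y z; have J3 := triple_powers_z x y z.
apply: idlD => //; first by apply: (hM 1%N) => //; apply: IH.
by apply: idlD => //; apply: (hM 1%N) => //; apply: IH.
Qed.

Hypotheses (hx : nzd Q0 x) (hy : nzd Q1 y) (hz : nzd Q2 z).
Variables (N c : nat).
Hypothesis fin : forall n, (N <= n)%N -> fin_length (ideal_pow I n).
Hypothesis growth : forall r T, (N <= T - r)%N -> (r <= T)%N ->
  (len (ideal_pow I T) <= len (ideal_pow I (T - r)) + r * (c * T * T))%N.
Hypothesis hR : noetherian R.

Lemma integral_of_mod_superficial a k : addI (ideal_pow I k.+1) (prI x) (a * y ^+ k) ->
  integral_over_ideal I a.
Proof.
move=> [b [_ [hb [[c' ->] e]]]].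
have cx n w : (n0.+1 <= n)%N -> ideal_pow I n.+1 (x * w) -> ideal_pow I n w.
  move=> hn hw; have [//| |] := @sx n w; first exact: ltnW.
    by apply: sub_addl.
  by move=> u [v [hu [-> ->]]]; rewrite addr0.
have eQ1 : Q1 = prI x.
  apply: set_ext => w; split; last exact: sub_addr.
  by move=> [_ [v [-> [hv ->]]]]; rewrite add0r.
have cy n w : (n0.+1 <= n)%N -> addI (ideal_pow I n.+1) (prI x) (y * w) ->
    addI (ideal_pow I n) (prI x) w.
  by rewrite -eQ1 => hn; apply: sy; apply: ltnW.
(* Multiplying the relation by [y^(n0+2)] makes its exponent exceed the threshold [n0.+1], which is
   itself taken positive. *)
have hb' : ideal_pow I (n0.+2 + k).+1 (b * y ^+ n0.+2).
  have := powM hb (pow1X n0.+2 Iy); apply: pow_le; lia.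
have e' : a * y ^+ (n0.+2 + k) = b * y ^+ n0.+2 + x * (c' * y ^+ n0.+2).
  by rewrite exprD mulrCA e; ring.
have ord := power_order_sqrt Ix Iy cx cy (leq_addr k n0.+2) hb' e'.
have [C hC] := power_order_bounded Ix Iy Iz hx hy hz superficial_reduction fin growth ord isT.
exact: integral_of_bounded hR hC.
Qed.
End SuperficialSequence.

(** * Existence of a regular superficial sequence *)

Section CohenMacaulay.
Variable R : comNzRingType.
Implicit Types (m I K L Q : R -> Prop).

Lemma prime_chain_le (P : nat -> R -> Prop) k l : (k <= l)%N -> prime_chain P l -> prime_chain P k.
Proof.
by move=> h [h1 h2]; split=> i hi; [apply: h1|apply: h2]; apply: leq_trans hi h.
Qed.

Lemma krull_dim_unique d d' : krull_dim R d -> krull_dim R d' -> d = d'.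
Proof.
move=> [[P hP] hn] [[P' hP'] hn']; have [h|h|//] := ltngtP d d'.
  by case: hn; exists P'; exact: (prime_chain_le h hP').
by case: hn'; exists P; exact: (prime_chain_le h hP).
Qed.

Lemma gen_ideal1 a : gen_ideal [:: a] = addI (@zeroI R) (prI a).
Proof.
apply: set_ext => w; split.
  move=> /gen_ideal_cons [r [v [/gen_ideal_nil -> ->]]].
  by exists 0, (r * a); split=> //; split; [exists r|ring].
move=> [_ [_ [-> [[r ->] ->]]]]; apply/gen_ideal_cons; exists r, 0.
by split; [exact/gen_ideal_nil|ring].
Qed.

Lemma gen_ideal2 a b : gen_ideal [:: a; b] = addI (addI (@zeroI R) (prI a)) (prI b).
Proof.
rewrite -gen_ideal1; apply: set_ext => w; split.
  move=> /gen_ideal_cons [r [_ [/gen_ideal_cons [t [v [/gen_ideal_nil -> ->]]] ->]]].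
  exists (r * a), (t * b); split; last by split; [exists t|ring].
  by apply/gen_ideal_cons; exists r, 0; split; [exact/gen_ideal_nil|ring].
move=> [_ [_ [/gen_ideal_cons [r [_ [/gen_ideal_nil -> ->]]] [[t ->] ->]]]].
apply/gen_ideal_cons; exists r, (t * b); split; last by ring.
by apply/gen_ideal_cons; exists t, 0; split; [exact/gen_ideal_nil|ring].
Qed.

Lemma regular_triple m : krull_dim R 3 -> cohen_macaulay m -> exists a b c,
  [/\ m a, m b & m c] /\
  [/\ nzd (@zeroI R) a, nzd (addI (@zeroI R) (prI a)) b &
      nzd (addI (addI (@zeroI R) (prI a)) (prI b)) c].
Proof.
move=> h3 [d [hd [[s [hs [hm hr]]] _]]].
rewrite (krull_dim_unique hd h3) in hs.
case: s hs hm hr => [|a [|b [|c []]]] // _ hm hr; exists a, b, c; split.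
  by split; [exact: (hm 0%N)|exact: (hm 1%N)|exact: (hm 2%N)].
split=> w.
- by have := hr 0%N isT w; rewrite /= => h /gen_ideal_nil /h /gen_ideal_nil.
- by have := hr 1%N isT w; rewrite /= gen_ideal1.
by have := hr 2%N isT w; rewrite /= gen_ideal2.
Qed.

Lemma nzd_swap Q (s y : R) : is_ideal Q -> nzd Q s -> nzd (addI Q (prI s)) y -> nzd (addI Q (prI y)) s.
Proof.
move=> hQ hs hy w [q [_ [hq [[r ->] e]]]].
have [q' [_ [hq' [[t ->] er]]]] : addI Q (prI s) r.
  apply: hy; exists (- q), (w * s); split; first exact: idlN.
  split; first by exists w.
  by rewrite mulrC [w * s]mulrC e; ring.
exists (w - t * y), (t * y); split; last by split; [exists t|ring].
apply: hs; have -> : s * (w - t * y) = q + y * q' by rewrite mulrBr e er; ring.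
by apply: idlD => //; apply: idlM.
Qed.

Lemma addI_swap K L M : addI (addI K L) M = addI (addI K M) L :> (R -> Prop).
Proof.
by apply: set_ext => w; split=> -[_ [v [[a [b [ha [hb ->]]]] [hv ->]]]];
  exists (a + v), b; (split; [exists a, v|split=> //; ring]).
Qed.

(** A regular sequence [a], [b], [c] is exchanged term by term. A generic [x] is regular modulo [0],
    [(a)] and [(a, b)], so by swapping [a], [b] is regular modulo [x]; a generic [y] then leaves [a]
    regular modulo [(x, y)], which provides [z]. *)
Lemma superficial_sequence m I : noetherian R -> local_ring m -> krull_dim R 3 ->
  cohen_macaulay m -> infinite_residue m -> m_primary m I ->
  exists g x y z n0, let Q1 := addI (@zeroI R) (prI x) in let Q2 := addI Q1 (prI y) in
    [/\ I = gen_ideal g,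
      [/\ I x, I y & I z],
      [/\ nzd (@zeroI R) x, nzd Q1 y & nzd Q2 z] &
      [/\ superficial g (@zeroI R) n0 x, superficial g Q1 n0 y & superficial g Q2 n0 z]].
Proof.
move=> hR hl h3 hcm [f hf] [[iI _] [_ hrad]].
have [g /set_ext eg] := noetherian_fg hR iI; exists g.
have [a [b [c [[ha hb hc] [na nb nc]]]]] := regular_triple h3 hcm.
have hlam : unit_differences f.
  by move=> i j hij; apply: (local_ring_unit hl) => /hf.
have powI Q u : m u -> nzd Q u -> exists2 s, gen_ideal g s & nzd Q s.
  by move=> /hrad [k hk] hu; exists (u ^+ k); [rewrite -eg|exact: nzdX].
pose X n := combination (nth 0 g) (size g) (f n).
have IX n : I (X n).
  rewrite eg; apply: idl_sum => [|i _]; first exact: gen_idealP.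
  by apply: idlM; [exact: gen_idealP|apply: gen_ideal_mem; apply: mem_nth].
pose Z := @zeroI R; have iZ : is_ideal Z := zero_ideal R.
have [N1 h1] := superficial_exists hR iZ hlam (powI _ _ ha na).
have iZa : is_ideal (addI Z (prI a)) by ideal.
have [N2 h2] := superficial_exists hR iZa hlam (powI _ _ hb nb).
have iZab : is_ideal (addI (addI Z (prI a)) (prI b)) by ideal.
have [N3 h3'] := superficial_exists hR iZab hlam (powI _ _ hc nc).
pose x := X (maxn N1 (maxn N2 N3)).
have [nx [nx0 sx]] := h1 (maxn N1 (maxn N2 N3)) ltac:(lia).
have [nxa _] := h2 (maxn N1 (maxn N2 N3)) ltac:(lia).
have [nxab _] := h3' (maxn N1 (maxn N2 N3)) ltac:(lia).
rewrite -/(X _) -/x in nx sx nxa nxab.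
have iQ1 : is_ideal (addI Z (prI x)) by ideal.
have ax : nzd (addI Z (prI x)) a by apply: nzd_swap.
have bx : nzd (addI (addI Z (prI x)) (prI a)) b by rewrite addI_swap; apply: nzd_swap.
have [M1 k1] := superficial_exists hR iQ1 hlam (powI _ _ ha ax).
have iQ1a : is_ideal (addI (addI Z (prI x)) (prI a)) by ideal.
have [M2 k2] := superficial_exists hR iQ1a hlam (powI _ _ hb bx).
pose y := X (maxn M1 M2).
have [ny [ny0 sy]] := k1 (maxn M1 M2) ltac:(lia).
have [nya _] := k2 (maxn M1 M2) ltac:(lia).
rewrite -/(X _) -/y in ny sy nya.
have iQ2 : is_ideal (addI (addI Z (prI x)) (prI y)) by ideal.
have ay : nzd (addI (addI Z (prI x)) (prI y)) a by apply: nzd_swap.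
have [L1 j1] := superficial_exists hR iQ2 hlam (powI _ _ ha ay).
have [nz [nz0 sz]] := j1 L1 (leqnn _).
exists x, y, (X L1), (maxn nx0 (maxn ny0 nz0)); split=> //; first by split; apply: IX.
split; [apply: superficial_le sx|apply: superficial_le sy|apply: superficial_le sz]; lia.
Qed.
End CohenMacaulay.

(** * Differences of the Hilbert polynomial and the numerical argument *)

Section HilbertPolynomial.
Variables e0 e1 e2 e3 : int.

(** First difference of [hilbP], of the shape of a Hilbert polynomial in dimension 2. *)
Definition hilbP1 (n : nat) : int := e0 * ('C(n.+1, 2))%:Z - e1 * n%:Z + e2.

Lemma hilbP_diff n : hilbP e0 e1 e2 e3 n.+1 = hilbP e0 e1 e2 e3 n + hilbP1 n.+1.
Proof.
rewrite /hilbP /hilbP1 !addn2 !addn1 (binS n.+2 2) (binS n.+1 1) bin1; lia.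
Qed.

Lemma hilbP1_diff n : hilbP1 n.+1 = hilbP1 n + (e0 * n.+1%:Z - e1).
Proof. rewrite /hilbP1 (binS n.+1 1) bin1; lia. Qed.

Lemma hilbP0 : hilbP e0 e1 e2 e3 0 = - e3.
Proof. by rewrite /hilbP !bin_small //; lia. Qed.

Lemma hilbP1_bound n : hilbP1 n.+1 <= ((`|e0| + `|e1| + `|e2|) * (n.+1 * n.+1))%N%:Z.
Proof.
have h : ('C(n.+2, 2) <= n.+1 * n.+1)%N.
  by rewrite bin2 /= -leq_double; have := odd_double_half (n.+2 * n.+1); lia.
have h0 : e0 * ('C(n.+2, 2))%:Z <= (`|e0| * (n.+1 * n.+1))%N%:Z.
  apply: (@le_trans _ _ (`|e0|%:Z * ('C(n.+2, 2))%:Z)); first by apply: ler_wpM2r => //; lia.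
  by rewrite -PoszM lez_nat leq_mul2l h orbT.
have h1 : - (e1 * n.+1%:Z) <= (`|e1| * (n.+1 * n.+1))%N%:Z.
  rewrite -mulNr; apply: (@le_trans _ _ (`|e1|%:Z * n.+1%:Z)); first by apply: ler_wpM2r => //; lia.
  by rewrite -PoszM lez_nat; apply: leq_mul => //; rewrite leq_pmulr.
have h2 : e2 <= (`|e2| * (n.+1 * n.+1))%N%:Z.
  apply: (@le_trans _ _ `|e2|%N%:Z); first by lia.
  by rewrite lez_nat leq_pmulr.
by rewrite /hilbP1 !mulnDl !PoszD; apply: lerD h2; apply: lerD h0 h1.
Qed.

(* [F], [f], [g], [h] are the Hilbert functions of the Ratliff-Rush filtration, of its image
   modulo [x], of the Ratliff-Rush filtration modulo [x], and of the latter's image modulo [y]. *)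
Section HilbertFunctions.
Variables (F f g h : nat -> nat) (B : nat).
Hypotheses (FS : forall n, F n.+1 = (f n.+1 + F n)%N) (gS : forall n, g n.+1 = (h n.+1 + g n)%N).
Hypothesis FP : forall n, (B <= n)%N -> (F n)%:Z = hilbP e0 e1 e2 e3 n.
Hypothesis gfB : forall n, (B <= n)%N -> g n = f n.

Lemma second_difference n : (B.+1 <= n)%N -> (h n.+1)%:Z = e0 * n.+1%:Z - e1.
Proof.
have fP k : (B <= k)%N -> (g k.+1)%:Z = hilbP1 k.+1.
  move=> hk; rewrite gfB ?leqW //; have := FP hk; have := FP (leqW hk).
  by rewrite hilbP_diff FS; lia.
case: n => // n hn; have := fP n hn; have := fP n.+1 (leqW hn).
by rewrite hilbP1_diff gS; lia.
Qed.

Lemma third_coefficient_le0 (l1 : nat) : F 0%N = 0%N -> g 0%N = 0%N -> (forall n, g n <= f n)%N ->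
  (forall n M, (B <= M)%N -> (n <= M)%N -> (h n.+1 + h M <= h n + h M.+1)%N) ->
  h 1%N = l1 -> e1 - e0 + l1%:Z = e2 -> e3 <= 0.
Proof.
move=> F0 g0 gf hB h1 e; have hP := second_difference.
(* Compare with the increment at a far index, where [h] is linear of slope [e0]. *)
have step n : (h n.+1)%:Z <= (h n)%:Z + e0.
  have := hB n (n + B).+2 ltac:(lia) ltac:(lia).
  have := hP (n + B).+1 ltac:(lia); have := hP (n + B).+2 ltac:(lia).
  by lia.
have steps n k : (h (n + k)%N)%:Z <= (h n)%:Z + e0 * k%:Z.
  elim: k => [|k IH]; first by rewrite addn0; lia.
  by rewrite addnS; have := step (n + k)%N; lia.
(* [h] meets the line of slope [e0] far out and its increments never exceed [e0], so it lies on or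
   above that line everywhere. *)
have lower n : e0 * n%:Z - e1 <= (h n)%:Z.
  have := steps n B.+2; rewrite !addnS hP; last by rewrite ltnS leq_addl.
  by lia.
(* At 1 the polynomial is [e0 - e1 + e2], which the hypothesis on the coefficients makes equal to
   [h 1 = l1]. *)
have gP n : hilbP1 n.+1 <= (g n.+1)%:Z.
  elim: n => [|n IH].
    by rewrite gS g0 h1 /hilbP1 binn; lia.
  by rewrite hilbP1_diff gS; have := lower n.+2; lia.
have FP' n : hilbP e0 e1 e2 e3 n + e3 <= (F n)%:Z.
  elim: n => [|n IH]; first by rewrite hilbP0 F0; lia.
  by rewrite hilbP_diff FS; have := gP n; have := gf n.+1; lia.
by have := FP' B; rewrite FP //; lia.
Qed.
End HilbertFunctions.
End HilbertPolynomial.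

(** * Ratliff-Rush filtrations with respect to one element *)

Section RatliffRush.
Variable R : comNzRingType.
Implicit Types (Q : R -> Prop).
Variable g : seq R.
Let I := gen_ideal g.

Definition ratliff_rush Q x n : R -> Prop :=
  fun w => exists s, addI (ideal_pow I (n + s)) Q (x ^+ s * w).

Lemma pow_addI_ideal Q n : is_ideal Q -> is_ideal (addI (ideal_pow I n) Q).
Proof. by move=> hQ; apply: add_ideal => //; exact: pow_ideal. Qed.

Lemma pow_addI_mul Q n k u w : is_ideal Q -> ideal_pow I k u ->
  addI (ideal_pow I n) Q w -> addI (ideal_pow I (k + n)) Q (u * w).
Proof.
move=> hQ hu [a [b [ha [hb ->]]]]; exists (u * a), (u * b).
by split; [exact: powM|split; [exact: idlM|ring]].
Qed.

Variables (Q : R -> Prop) (x : R).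
Hypotheses (hQ : is_ideal Q) (Ix : I x).

Lemma ratliff_rush_raise n w s t : (s <= t)%N ->
  addI (ideal_pow I (n + s)) Q (x ^+ s * w) -> addI (ideal_pow I (n + t)) Q (x ^+ t * w).
Proof.
move=> /subnK <- h; rewrite exprD -mulrA addnCA.
by apply: pow_addI_mul => //; apply: pow1X.
Qed.

Lemma ratliff_rush_ideal n : is_ideal (ratliff_rush Q x n).
Proof.
have iA k := pow_addI_ideal k hQ.
split; first by exists 0%N; rewrite mulr0; apply: idl0.
split=> [u v [s hs] [t ht]|a u [s hs]]; last by exists s; rewrite mulrCA; apply: idlM.
exists (maxn s t); rewrite mulrDr; apply: idlD => //.
  exact: ratliff_rush_raise (leq_maxl s t) hs.
exact: ratliff_rush_raise (leq_maxr s t) ht.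
Qed.

Lemma sub_ratliff_rush n : subset (addI (ideal_pow I n) Q) (ratliff_rush Q x n).
Proof. by move=> w hw; exists 0%N; rewrite addn0 mul1r. Qed.

(** The reason for passing to this filtration: the colon by [x] drops the index by exactly one in
    every degree, so lengths add up from [n = 0] on, whereas for powers of [I] this holds only in
    high degrees. *)
Lemma ratliff_rush_quot n : quotI (ratliff_rush Q x n.+1) x = ratliff_rush Q x n.
Proof.
apply: set_ext => w; split=> -[s hs].
  by exists s.+1; rewrite addnS -addSn exprSr -mulrA.
exists s; have := pow_addI_mul hQ (pow1 Ix) hs.
by rewrite add1n addSn; congr (addI _ _ _); ring.
Qed.

Lemma ratliff_rush0 : ratliff_rush Q x 0 = fun _ => True.
Proof. by apply: set_ext => w; split=> // _; apply: sub_ratliff_rush; apply: sub_addl. Qed.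

Lemma ratliff_rushS n u w : I u -> ratliff_rush Q x n w -> ratliff_rush Q x n.+1 (u * w).
Proof.
move=> Iu [s hs]; exists s; rewrite mulrCA addSn.
exact: pow_addI_mul hQ (pow1 Iu) hs.
Qed.

Variable n0 : nat.
Hypothesis sx : superficial g Q n0 x.

Lemma superficialX s n w : (n0 <= n)%N -> addI (ideal_pow I (n + s)) Q (x ^+ s * w) ->
  addI (ideal_pow I n) Q w.
Proof.
move=> hn; elim: s w => [|s IH] w; first by rewrite addn0 mul1r.
rewrite exprS -mulrA addnS => /sx h; apply: IH; apply: h.
exact: leq_trans hn (leq_addr _ _).
Qed.

Lemma ratliff_rush_eq n : (n0 <= n)%N -> ratliff_rush Q x n = addI (ideal_pow I n) Q.
Proof.
move=> hn; apply: set_ext => w; split; last exact: sub_ratliff_rush.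
by move=> [s]; apply: superficialX.
Qed.

Lemma superficial_quot n : (n0 <= n)%N ->
  quotI (addI (ideal_pow I n.+1) Q) x = addI (ideal_pow I n) Q.
Proof.
move=> hn; apply: set_ext => w; split; first exact: sx.
exact: pow_addI_mul hQ (pow1 Ix).
Qed.

Variables (N : nat).
Hypothesis fin : forall n, (N <= n)%N -> fin_length (ideal_pow I n).

Lemma fin_length_of_pow n (K : R -> Prop) : is_ideal K -> subset (ideal_pow I n) K -> fin_length K.
Proof.
move=> hK h; apply: (fin_length_le hK _ (fin (leq_maxl N n)) (pow_ideal _ _)) => w.
by move/(pow_le (leq_maxr N n)); apply: h.
Qed.

Lemma fin_length_ratliff_rush n : fin_length (ratliff_rush Q x n).
Proof.
apply: (@fin_length_of_pow n); first exact: ratliff_rush_ideal.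
by move=> w hw; apply: sub_ratliff_rush; apply: sub_addl.
Qed.

Lemma len_ratliff_rushS n : len (ratliff_rush Q x n.+1) =
  (len (addI (ratliff_rush Q x n.+1) (prI x)) + len (ratliff_rush Q x n))%N.
Proof.
rewrite -(ratliff_rush_quot n); apply: len_add_quot; first exact: ratliff_rush_ideal.
exact: fin_length_ratliff_rush.
Qed.
End RatliffRush.

(** * Comparison of the two filtrations and the sign of [e3] *)

Lemma addIA_eq (R : comNzRingType) (K L M : R -> Prop) : addI (addI K L) M = addI K (addI L M).
Proof. by apply: set_ext => w; split; [exact: addIA|exact: addIAr]. Qed.

(** Each of the [r] increments is a value of the quadratic polynomial [hilbP1], at most a constant
    times [T^2]. *)
Lemma growth_of_hilbP (R : comNzRingType) (I : R -> Prop) (e0 e1 e2 e3 : int) N r T :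
  (forall n, (N <= n)%N -> (len (ideal_pow I n))%:Z = hilbP e0 e1 e2 e3 n) ->
  (N <= T - r)%N -> (r <= T)%N ->
  (len (ideal_pow I T) <= len (ideal_pow I (T - r)) + r * ((`|e0| + `|e1| + `|e2|) * T * T))%N.
Proof.
move=> hP; set c := (_ + _ + _)%N; elim: r => [|r IH] hN hr; first by rewrite subn0 addn0.
have e : (T - r = (T - r.+1).+1)%N by lia.
have h := IH ltac:(lia) (ltnW hr); apply: leq_trans h _.
rewrite mulSn addnA leq_add2r -lez_nat e PoszD !hP // ?leqW // hilbP_diff lerD2l.
apply: le_trans (hilbP1_bound _ _ _ _) _; rewrite -/c lez_nat -e -mulnA leq_mul2l.
by apply/orP; right; apply: leq_mul; exact: leq_subr.
Qed.

Theorem theorem1p8 (R : comNzRingType) (m I : R -> Prop) (e0 e1 e2 e3 : int) :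
  noetherian R -> local_ring m -> krull_dim R 3 -> cohen_macaulay m ->
  infinite_residue m ->
  m_primary m I -> integrally_closed I ->
  (exists N : nat, forall n : nat, (N <= n)%N ->
      exists l : nat, quot_length (ideal_pow I n) l /\ l%:Z = hilbP e0 e1 e2 e3 n) ->
  forall l1 : nat, quot_length I l1 ->
  e1 - e0 + l1%:Z = e2 -> e3 <= 0.
Proof.
move=> hR hl h3 hcm hf hp hic [N hN] l1 /quot_length_has_length /len_eq hl1 he.
have fin n : (N <= n)%N -> fin_length (ideal_pow I n).
  by move=> /hN [l [/quot_length_has_length h _]]; exists l.
have hP n : (N <= n)%N -> (len (ideal_pow I n))%:Z = hilbP e0 e1 e2 e3 n.
  by move=> /hN [l [/quot_length_has_length /len_eq -> h]].
have subm : subset I m.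
  by case: hp => _ [_ hr] u hu; apply/hr; exists 1%N.
have [g [x [y [z [n0 [eI [Ix Iy Iz] [nx ny nz] [sx sy sz]]]]]]] :=
  superficial_sequence hR hl h3 hcm hf hp.
subst I; set I := gen_ideal g in hp hic hN hl1 fin hP subm Ix Iy Iz.
set Q0 := @zeroI R in nx ny nz sx sy sz; set Q1 := addI Q0 (prI x) in ny nz sy sz.
set Q2 := addI Q1 (prI y) in nz sz; pose Q3 := addI Q2 (prI z).
have iI : is_ideal I := gen_idealP g.
have iQ0 : is_ideal Q0 := zero_ideal R.
have iQ1 : is_ideal Q1 by rewrite /Q1; ideal.
have iQ2 : is_ideal Q2 by rewrite /Q2; ideal.
have iQ3 : is_ideal Q3 by rewrite /Q3; ideal.
have addQ0 (K : R -> Prop) : addI K Q0 = K.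
  apply: set_ext => w; split; last exact: sub_addl.
  by move=> [u [v [hu [-> ->]]]]; rewrite addr0.
have Q0x : Q1 = prI x.
  apply: set_ext => w; split; last exact: sub_addr.
  by move=> [_ [v [-> [hv ->]]]]; rewrite add0r.
pose F := ratliff_rush g Q0 x; pose G := ratliff_rush g Q1 y.
have iF n : is_ideal (F n) by apply: ratliff_rush_ideal.
have iG n : is_ideal (G n) by apply: ratliff_rush_ideal.
have GQ1 n : subset Q1 (G n).
  by move=> w hw; apply: sub_ratliff_rush; apply: sub_addr => //; exact: pow_ideal.
(* From [x^s w] in [I^(n+s)], multiplying by [y^n0] reaches a degree where [x^s] can be cancelled,
   so [y^n0 w] is in [I^(n+n0)]. *)
have FG n : subset (addI (F n) (prI x)) (G n).
  apply: addI_sub => //; last by rewrite -Q0x.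
  move=> w [s hs]; exists n0; apply: sub_addl => //.
  rewrite -[X in X _]addQ0; apply: (superficialX (s := s) sx); first exact: leq_addl.
  rewrite mulrCA [(n + n0)%N]addnC -addnA.
  by apply: pow_addI_mul => //; apply: pow1X.
have Feq n : (n0 <= n)%N -> F n = ideal_pow I n.
  by move=> hn; rewrite /F (ratliff_rush_eq sx hn) addQ0.
have Geq n : (n0 <= n)%N -> G n = addI (ideal_pow I n) Q1 by apply: ratliff_rush_eq.
have GyE n : (n0 <= n)%N -> addI (G n) (prI y) = addI (ideal_pow I n) Q2.
  by move=> hn; rewrite Geq // addIA_eq.
pose f n := len (addI (F n) (prI x)); pose h n := len (addI (G n) (prI y)).
have lenF n : len (F n.+1) = (f n.+1 + len (F n))%N by apply: (len_ratliff_rushS _ _ fin).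
have lenG n : len (G n.+1) = (h n.+1 + len (G n))%N by apply: (len_ratliff_rushS _ _ fin).
have subF n : subset (ideal_pow I n) (F n).
  by move=> w hw; apply: sub_ratliff_rush; apply: sub_addl.
have subG n : subset (ideal_pow I n) (G n).
  by move=> w hw; apply: sub_ratliff_rush; apply: sub_addl.
have finG n : fin_length (G n) by apply: (fin_length_ratliff_rush _ _ fin).
have Gf n : (len (G n) <= f n)%N.
  apply: len_le => //; first by ideal.
  apply: (fin_length_of_pow fin) (_ : subset (ideal_pow I n) _); first by ideal.
  by move=> w /subF hw; apply: sub_addl => //; ideal.
have subG3 n : subset (ideal_pow I n) (addI (addI (G n) (prI y)) (prI z)).
  by move=> w /subG hw; do 2!(apply: sub_addl; first by ideal).
have finGy n : fin_length (addI (G n) (prI y)).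
  apply: (fin_length_of_pow fin) (_ : subset (ideal_pow I n) _); first by ideal.
  by move=> w /subG hw; apply: sub_addl => //; ideal.
have lenz n : h n.+1 = (len (addI (addI (G n.+1) (prI y)) (prI z)) + len (quotI (addI (G n.+1) (prI y)) z))%N.
  by apply: len_add_quot => //; ideal.
have GyzE n : (n0 <= n)%N -> addI (addI (G n) (prI y)) (prI z) = addI (ideal_pow I n) Q3.
  by move=> hn; rewrite GyE // addIA_eq.
have lenz_eq n : (n0 <= n)%N -> h n.+1 = (len (addI (ideal_pow I n.+1) Q3) + h n)%N.
  move=> hn; rewrite lenz GyzE ?leqW // GyE ?leqW //; congr (_ + _)%N.
  by rewrite (superficial_quot iQ2 Iz sz hn) /h GyE.
(* Both increments of [h] are measured through [z]: the part modulo [z] is largest at [M], and the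
   colon by [z] contains [G n + (y)], so its colength is at most [h n]. *)
have hstep n M : (n0 <= M)%N -> (n <= M)%N -> (h n.+1 + h M <= h n + h M.+1)%N.
  move=> hM hnM; rewrite (lenz_eq M hM) lenz.
  have ha : (len (addI (addI (G n.+1) (prI y)) (prI z)) <= len (addI (ideal_pow I M.+1) Q3))%N.
    apply: len_le; [by rewrite -GyzE ?leqW //; ideal|by ideal| |].
      rewrite -addIA_eq -addIA_eq; do 2!(apply: addIS => //).
      by apply: addI_sub => // w /(pow_le (_ : n < M.+1)%N) h0; apply: subG; apply: h0.
    apply: (fin_length_of_pow fin) (_ : subset (ideal_pow I M.+1) _); first exact: pow_addI_ideal.
    by apply: sub_addl.
  have hb : (len (quotI (addI (G n.+1) (prI y)) z) <= h n)%N.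
    apply: len_le; [by ideal|by ideal| |exact: finGy].
    move=> _ [u [_ [hu [[r ->] ->]]]]; exists (z * u), (z * r * y); split.
      exact: ratliff_rushS.
    by split; [exists (z * r)|ring].
  by lia.
pose B := maxn N n0.
have FP n : (B <= n)%N -> (len (F n))%:Z = hilbP e0 e1 e2 e3 n.
  by rewrite geq_max => /andP[h1 h2]; rewrite Feq // hP.
have gfB n : (B <= n)%N -> len (G n) = f n.
  by rewrite geq_max => /andP[_ hn]; rewrite /f Feq // Geq // Q0x.
have hh := second_difference lenF lenG FP gfB.
have lenQ3 n : (B.+3 <= n)%N -> (len (addI (ideal_pow I n) Q3))%:Z = e0.
  case: n => [|[|n]] // hn; have [h1 h2] : (B.+1 <= n)%N /\ (n0 <= n)%N.
    by move: hn; rewrite /B; lia.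
  have := hh n h1; have := hh n.+1 (leqW h1); have := lenz_eq n.+1 (leqW h2); lia.
(* The colength of [I^n + Q3] is eventually the constant [e0], so consecutive terms coincide and
   Nakayama puts [I^n] inside [Q3]. *)
have hQ3 n : (B.+3 <= n)%N -> subset (ideal_pow I n) Q3.
  move=> hn; apply: (nakayama_pow hR hl) => // w hw.
  have [u [v [hu [hv ->]]]] : addI (ideal_pow I n.+1) Q3 w.
    apply: (len_eq_sub (L := addI (ideal_pow I n) Q3)).
    - exact: pow_addI_ideal.
    - exact: pow_addI_ideal.
    - by apply: addIS => //; exact: pow_leS.
    - apply: (fin_length_of_pow fin) (_ : subset (ideal_pow I n.+1) _); first exact: pow_addI_ideal.
      by apply: sub_addl.
    - by have := lenQ3 n hn; have := lenQ3 n.+1 (leqW hn); lia.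
    by apply: sub_addl.
  by exists v, u; split=> //; split=> //; rewrite addrC.
(* Membership in [G 1] says that [y^s w] is in [I^(s+1) + (x)], so [w] is integral over [I]. The
   threshold [n1] serves both superficiality and the inclusion in [Q3]. *)
have key w : G 1%N w -> I w.
  move=> [s hs]; apply: hic; pose n1 := maxn n0 B.+3.
  have n01 : (n0 <= n1)%N := leq_maxl _ _.
  apply: (integral_of_mod_superficial Ix Iy Iz (superficial_le n01 sx)
    (superficial_le n01 sy) (superficial_le n01 sz) _ nx ny nz fin
    (fun r T => growth_of_hilbP (r := r) (T := T) hP) hR (k := s)).
    by move=> n hn; apply: hQ3; apply: leq_trans hn; apply: leq_maxr.
  by move: hs; rewrite add1n mulrC Q0x.
have G1 : addI (G 1%N) (prI y) = I.
  apply: set_ext => w; split; last by move=> hw; apply: sub_addl; [exact: pr_ideal|apply: subG; exact: pow1].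
  by move: w; apply: addI_sub => //; apply: pr_sub.
apply: (third_coefficient_le0 lenF lenG FP gfB _ _ Gf (l1 := l1)) he.
- by rewrite /F ratliff_rush0 // len_full.
- by rewrite /G ratliff_rush0 // len_full.
- by move=> n M hM; apply: hstep; apply: leq_trans hM; apply: leq_maxr.
by rewrite /h G1.
Qed.
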